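(* Let $d\ge 1$ and let $L\subset\mathbb{R}^d$ be a lattice. Then $L$ is strict periodic extreme if and only if $L$ is extreme and non-floating.
   Context: A lattice in $\mathbb{R}^d$ is a full rank discrete subgroup of $\mathbb{R}^d$. For a positive integer $m$, an $m$-periodic set in $\mathbb{R}^d$ is a (disjoint) union $\Lambda'=\bigcup_{i=1}^m(\boldsymbol{t}'_i+L')$ of $m$ translates of a lattice $L'$. Parameter space. Let $\mathcal{S}^d$ be the space of real symmetric $d\times d$ matrices, with inner product $\langle A,B\rangle=\operatorname{trace}(AB)$, and let $\mathcal{S}^d_{>0}\subset\mathcal{S}^d$ be the set of positive definite ones. For $Q\in\mathcal{S}^d$ and $\boldsymbol{x}\in\mathbb{R}^d$ write $Q[\boldsymbol{x}]=\boldsymbol{x}^tQ\boldsymbol{x}$. Put $\mathcal{S}^{d,m}=\mathcal{S}^d\times\mathbb{R}^{d\times(m-1)}$, a Euclidean space with $\langle (Q,\boldsymbol{t}),(Q',\boldsymbol{t}')\rangle=\langle Q,Q'\rangle+\sum_{i=1}^{m-1}\boldsymbol{t}_i^t\boldsymbol{t}'_i$, and $\mathcal{S}^{d,m}_{>0}=\mathcal{S}^d_{>0}\times\mathbb{R}^{d\times(m-1)}$, whose elements are called periodic forms. For $X=(Q,\boldsymbol{t})\in\mathcal{S}^{d,m}_{>0}$ the columns of $\boldsymbol{t}$ are $\boldsymbol{t}_1,\dots,\boldsymbol{t}_{m-1}$, and one sets $\boldsymbol{t}_m=\boldsymbol{0}$. Representation. A periodic form $X=(Q,\boldsymbol{t})\in\mathcal{S}^{d,m}_{>0}$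 represents a periodic set $\Lambda'\subset\mathbb{R}^d$ if the translates $\boldsymbol{t}_i+\mathbb{Z}^d$ ($1\le i\le m$) are pairwise disjoint and, for some $A\in\mathrm{GL}_d(\mathbb{R})$ with $A^tA=Q$, the set $\Lambda'$ is the image of $A\bigl(\bigcup_{i=1}^m(\boldsymbol{t}_i+\mathbb{Z}^d)\bigr)$ under an isometry of $\mathbb{R}^d$. A given periodic set, in particular a lattice, has infinitely many representations, for varying $m$ and varying choices of underlying lattice and basis. Minimum and density. The generalized arithmetical minimum of $X=(Q,\boldsymbol{t})\in\mathcal{S}^{d,m}_{>0}$ is $$\lambda(X)=\min\{Q[\boldsymbol{t}_i-\boldsymbol{t}_j-\boldsymbol{v}]: 1\le i,j\le m,\ \boldsymbol{v}\in\mathbb{Z}^d,\ \boldsymbol{v}\neq\boldsymbol{0}\text{ if }i=j\}.$$ The sphere packing density of $X$ is $$\delta(X)=\left(\frac{\lambda(X)}{(\det Q)^{1/d}}\right)^{d/2} m\,\operatorname{vol}(B^d)/2^d,$$ where $B^d$ is the unit ball of $\mathbb{R}^d$. Extremality. $X\in\mathcal{S}^{d,m}_{>0}$ is isolated $m$-extreme if any sufficiently small change of $X$ preserving $\lambda(X)$ necessarily lowers $\delta$, i.e. there is a neighbourhood $U$ of $X$ in $\mathcal{S}^{d,m}_{>0}$ such that $\delta(X')<\delta(X)$ for all $X'\in U\setminus\{X\}$ with $\lambda(X')=\lambda(X)$. A periodic point set is strict periodic extreme if, for every $m\ge1$, every representation $X\in\mathcal{S}^{d,m}_{>0}$ of it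 is isolated $m$-extreme. A lattice $L$ is extreme if its sphere packing density is a local maximum among lattices, i.e. if $L=A\mathbb{Z}^d$ with $A\in\mathrm{GL}_d(\mathbb{R})$ and $Q=A^tA\in\mathcal{S}^d_{>0}=\mathcal{S}^{d,1}_{>0}$ is a local maximum of $\delta$ on $\mathcal{S}^d_{>0}$ (this does not depend on the choice of $A$). Floating. A periodic point set $\Lambda$ is floating if it has a representation $\Lambda=\bigcup_{i=1}^m(\boldsymbol{t}_i+L')$ with a lattice $L'$ such that it is possible to continuously move a strict subset of the $m$ translates of $L'$ without lowering the minimum distance among elements of $\Lambda$. In the parameter space this means: for some $m$ there is a representation $X\in\mathcal{S}^{d,m}_{>0}$ of $\Lambda$ that is floating, where $X$ is called floating if there exists a purely translational change $N=(0,\boldsymbol{t}^N)\in\mathcal{S}^{d,m}$, $N\neq0$, and an $\epsilon_0>0$ with $\lambda(X+\epsilon N)\ge\lambda(X)$ for all $\epsilon\in[0,\epsilon_0]$. The parameter-space formulation is to be taken as the formal definition. A periodic set is non-floating if it is not floating. *)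

(* Defs.v *)
From HB Require Import structures.
From mathcomp Require Import all_boot all_order all_algebra.
From mathcomp Require Import all_classical all_reals all_analysis.

Set Implicit Arguments.
Unset Strict Implicit.
Unset Printing Implicit Defensive.

Import Order.TTheory GRing.Theory Num.Theory.
Import numFieldNormedType.Exports.

Local Open Scope classical_set_scope.
Local Open Scope ring_scope.

(** Points of [R^d] are column vectors ['cV[R]_d].  The library norm on matrices
    is the max norm, hence [enorm] for the Euclidean one; both norms induce the
    library topology on matrices. *)

Definition qform (R : realType) (d : nat) (Q : 'M[R]_d) (x : 'cV[R]_d) : R :=
  (x^T *m Q *m x) 0 0.

Definition enorm (R : realType) (d : nat) (x : 'cV[R]_d) : R :=
  Num.sqrt ((x^T *m x) 0 0).

Definition isometry (R : realType) (d : nat) (f : 'cV[R]_d -> 'cV[R]_d) : Prop :=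
  forall x y, enorm (f x - f y) = enorm (x - y).

(** Lebesgue measure on [R^n], as the [n]-fold product of the library's
    [lebesgue_measure] on [R]: the recursion is the formula defining the
    library's binary product measure, [(m1 \x m2) A] being the [m1]-integral of
    the [m2]-measures of the sections of [A].  Meaningful on Borel sets. *)
Fixpoint volume (R : realType) (n : nat) : set 'cV[R]_n -> \bar R :=
  match n with
  | 0 => fun A => (\1_A (0 : 'cV[R]_0))%:E
  | n'.+1 => fun A : set 'cV[R]_(1 + n') =>
      (\int[@lebesgue_measure R]_x
         volume [set y : 'cV[R]_n' | A (col_mx (x%:M : 'cV[R]_1) y)])%E
  end.

Definition unit_ball_volume (R : realType) (d : nat) : R :=
  fine (volume [set x : 'cV[R]_d | enorm x <= 1]).

Definition is_lattice (R : realType) (d : nat) (L : set 'cV[R]_d) : Prop :=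
  [/\ L 0 /\ (forall x y, L x -> L y -> L (x - y)),
      L `<=` isolated L
    & exists B : 'M[R]_d, \rank B = d /\ forall j, L (col j B)].

Definition int_points (R : realType) (d : nat) : set 'cV[R]_d :=
  range (fun v : 'cV[int]_d => map_mx intr v).
Arguments int_points : clear implicits.

(** The number [m >= 1] of translates is written [n.+1], so that [t] has [n]
    columns.  ['M[R]_d * 'M[R]_(d, n)] is the ambient space of [S^{d,n+1}];
    symmetry of the first component is part of [periodic_form]. *)
Definition periodic_form (R : realType) (d n : nat)
    (X : 'M[R]_d * 'M[R]_(d, n)) : Prop :=
  X.1^T = X.1 /\ forall x : 'cV[R]_d, x != 0 -> 0 < qform X.1 x.

(** [t_1, ..., t_m], where the last one, of index [ord_max], is zero. *)
Definition transl (R : realType) (d n : nat) (t : 'M[R]_(d, n))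
    (i : 'I_n.+1) : 'cV[R]_d :=
  if unlift ord_max i is Some j then col j t else 0.

Definition translate (R : realType) (d n : nat) (t : 'M[R]_(d, n))
    (i : 'I_n.+1) : set 'cV[R]_d :=
  [set transl t i + z | z in int_points R d].

Definition represents (R : realType) (d n : nat)
    (X : 'M[R]_d * 'M[R]_(d, n)) (Lam : set 'cV[R]_d) : Prop :=
  [/\ periodic_form X,
      trivIset setT (translate X.2)
    & exists A : 'M[R]_d, exists f : 'cV[R]_d -> 'cV[R]_d,
        [/\ A \in unitmx, A^T *m A = X.1, isometry f
          & Lam = f @` (mulmx A @` \bigcup_i translate X.2 i)]].

(** For periodic forms (and [0 < d]) this infimum is a minimum. *)
Definition lambda (R : realType) (d n : nat)
    (X : 'M[R]_d * 'M[R]_(d, n)) : R :=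
  inf [set r | exists (i j : 'I_n.+1) (v : 'cV[int]_d),
         (i = j -> v != 0) /\
         r = qform X.1 (transl X.2 i - transl X.2 j - map_mx intr v)].

Definition delta (R : realType) (d n : nat)
    (X : 'M[R]_d * 'M[R]_(d, n)) : R :=
  (lambda X / (\det X.1) `^ (d%:R^-1)) `^ (d%:R / 2)
    * n.+1%:R * unit_ball_volume R d / 2 ^+ d.

(** Neighbourhoods are taken in the ambient space and restricted by
    [periodic_form], i.e. they are neighbourhoods in [S^{d,m}_{>0}]. *)
Definition isolated_extreme (R : realType) (d n : nat)
    (X : 'M[R]_d * 'M[R]_(d, n)) : Prop :=
  \forall Y \near X,
    periodic_form Y -> Y <> X -> lambda Y = lambda X -> delta Y < delta X.

Definition strict_periodic_extreme (R : realType) (d : nat)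
    (Lam : set 'cV[R]_d) : Prop :=
  forall (n : nat) (X : 'M[R]_d * 'M[R]_(d, n)),
    represents X Lam -> isolated_extreme X.

Definition extreme (R : realType) (d : nat) (L : set 'cV[R]_d) : Prop :=
  exists A : 'M[R]_d,
    [/\ A \in unitmx, L = mulmx A @` int_points R d
      & let X : 'M[R]_d * 'M[R]_(d, 0) := (A^T *m A, 0) in
        \forall Y \near X, periodic_form Y -> delta Y <= delta X].

(** Purely translational change [N = (0, tN)]; the entry [t_m = 0] stays fixed. *)
Definition floating_form (R : realType) (d n : nat)
    (X : 'M[R]_d * 'M[R]_(d, n)) : Prop :=
  exists (tN : 'M[R]_(d, n)) (eps0 : R),
    [/\ tN != 0, 0 < eps0
      & forall eps : R, 0 <= eps <= eps0 ->
          lambda X <= lambda (X.1, X.2 + eps *: tN)].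

Definition floating (R : realType) (d : nat) (Lam : set 'cV[R]_d) : Prop :=
  exists (n : nat) (X : 'M[R]_d * 'M[R]_(d, n)),
    represents X Lam /\ floating_form X.

(* Main.v *)
Require Import Defs.
From mathcomp Require Import all_boot all_order all_algebra.
From mathcomp Require Import all_classical all_reals all_analysis.
From mathcomp Require Import ring lra zify.

(** Represent [L] as [A (t_1 + Z^d) \cup ... \cup A (t_m + Z^d)] and write a
    nearby periodic form as [(A^T (1 + K) A, t + s)].  A minimal vector [l] of [L]
    occurs at every translate [i], as [l = A (t_i - t_j - v)]; with
    [u_i = A (s_i - s_j)], keeping [lambda] forces
    [K[l] + 2 <l, u_i> + 2 l^T K u_i + (1 + K)[u_i] >= 0].
    If the form does not float, then every [s <> 0] makes some [<l, u_i>] negative,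
    and by compactness [<l, u_i> <= - c |s|]; hence [|s| = O(|K|)].  Since
    [i |-> j] is a permutation, summing the constraint over [i] kills the terms
    linear in [u], so that [K[l] >= - O(|K|^2)] for all minimal [l].  Extremality of
    [L] says that [K <> 0] with all [K[l] >= 0] has positive trace, so by
    compactness again [tr K >= c |K|], which gives [det (1 + K) > 1]: the density
    drops.  Conversely, a floating motion, or a lattice deformation that raises
    the density, yields after rescaling by [lambda X / lambda Y] a periodic form [Y]
    with [lambda Y = lambda X] that contradicts isolated extremality. *)

Set Implicit Arguments.
Unset Strict Implicit.
Unset Printing Implicit Defensive.

Import Order.TTheory GRing.Theory Num.Theory.
Import numFieldNormedType.Exports.

Local Open Scope classical_set_scope.
Local Open Scope ring_scope.

(** * Bilinear and quadratic forms, positive definiteness *)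

Definition bform (R : realType) (d : nat) (Q : 'M[R]_d) (x y : 'cV[R]_d) : R :=
  (x^T *m Q *m y) 0 0.

Definition pos_def (R : realType) (d : nat) (Q : 'M[R]_d) : Prop :=
  Q^T = Q /\ forall x : 'cV[R]_d, x != 0 -> 0 < qform Q x.

Section Bilinear.
Variables (R : realType) (d : nat).
Implicit Types (Q H : 'M[R]_d) (x y z : 'cV[R]_d) (a : R).

Lemma qformE Q x : qform Q x = bform Q x x. Proof. by []. Qed.

Lemma bformDl Q x y z : bform Q (x + y) z = bform Q x z + bform Q y z.
Proof. by rewrite /bform linearD !mulmxDl mxE. Qed.

Lemma bformDr Q x y z : bform Q z (x + y) = bform Q z x + bform Q z y.
Proof. by rewrite /bform mulmxDr mxE. Qed.

Lemma bformZl Q a x y : bform Q (a *: x) y = a * bform Q x y.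
Proof. by rewrite /bform linearZ -!scalemxAl mxE. Qed.

Lemma bformZr Q a x y : bform Q x (a *: y) = a * bform Q x y.
Proof. by rewrite /bform -scalemxAr mxE. Qed.

Lemma bformNl Q x y : bform Q (- x) y = - bform Q x y.
Proof. by rewrite -scaleN1r bformZl mulN1r. Qed.

Lemma bformNr Q x y : bform Q x (- y) = - bform Q x y.
Proof. by rewrite -scaleN1r bformZr mulN1r. Qed.

Lemma bform0l Q y : bform Q 0 y = 0.
Proof. by rewrite -(scale0r 0) bformZl mul0r. Qed.

Lemma bform0r Q y : bform Q y 0 = 0.
Proof. by rewrite -(scale0r 0) bformZr mul0r. Qed.

Lemma bform_suml Q (I : finType) (F : I -> 'cV[R]_d) y :
  bform Q (\sum_i F i) y = \sum_i bform Q (F i) y.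
Proof.
by elim/big_rec2: _ => [|i a b _ <-]; rewrite ?bform0l ?bformDl.
Qed.

Lemma bform_sumr Q (I : finType) (F : I -> 'cV[R]_d) y :
  bform Q y (\sum_i F i) = \sum_i bform Q y (F i).
Proof.
by elim/big_rec2: _ => [|i a b _ <-]; rewrite ?bform0r ?bformDr.
Qed.

Lemma bform_mxD Q H x y : bform (Q + H) x y = bform Q x y + bform H x y.
Proof. by rewrite /bform mulmxDr mulmxDl mxE. Qed.

Lemma bform_mxZ a Q x y : bform (a *: Q) x y = a * bform Q x y.
Proof. by rewrite /bform -scalemxAr -scalemxAl mxE. Qed.

Lemma bformC Q x y : Q^T = Q -> bform Q x y = bform Q y x.
Proof.
move=> Qs; rewrite /bform -[LHS]mulr1; have -> : x^T *m Q *m y = (y^T *m Q *m x)^T.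
  by rewrite !trmx_mul trmxK Qs mulmxA.
by rewrite mxE mulr1.
Qed.

Lemma bform_congr Q (A : 'M[R]_d) x y :
  bform (A^T *m Q *m A) x y = bform Q (A *m x) (A *m y).
Proof. by rewrite /bform trmx_mul !mulmxA. Qed.

Lemma qformD Q x y : Q^T = Q ->
  qform Q (x + y) = qform Q x + 2 * bform Q x y + qform Q y.
Proof.
by move=> Qs; rewrite !qformE bformDl !bformDr (bformC y x Qs); ring.
Qed.

Lemma qform1D x y :
  qform (1%:M : 'M[R]_d) (x + y) = qform 1%:M x + 2 * bform 1%:M x y + qform 1%:M y.
Proof. by rewrite qformD // trmx1. Qed.

Lemma qformB Q x y : Q^T = Q ->
  qform Q (x - y) = qform Q x - 2 * bform Q x y + qform Q y.
Proof.
move=> Qs; rewrite qformD // bformNr !qformE bformNl bformNr; ring.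
Qed.

Lemma qformZ Q a x : qform Q (a *: x) = a ^+ 2 * qform Q x.
Proof. by rewrite !qformE bformZl bformZr mulrA expr2. Qed.

Lemma qform_mxD Q H x : qform (Q + H) x = qform Q x + qform H x.
Proof. exact: bform_mxD. Qed.

Lemma qform_mxZ a Q x : qform (a *: Q) x = a * qform Q x.
Proof. exact: bform_mxZ. Qed.

Lemma qform_congr Q (A : 'M[R]_d) x :
  qform (A^T *m Q *m A) x = qform Q (A *m x).
Proof. exact: bform_congr. Qed.

Lemma qform1E x : qform 1%:M x = \sum_i x i 0 ^+ 2.
Proof.
rewrite /qform mulmx1 mxE; apply: eq_bigr => i _.
by rewrite mxE expr2.
Qed.

Lemma qform1_ge0 x : 0 <= qform 1%:M x.
Proof. by rewrite qform1E; apply: sumr_ge0 => i _; apply: sqr_ge0. Qed.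

Lemma qform1_gt0 x : x != 0 -> 0 < qform 1%:M x.
Proof.
move=> x0; rewrite lt_neqAle qform1_ge0 andbT eq_sym qform1E.
apply: contra x0 => /eqP s0; apply/eqP/colP => i; rewrite mxE.
have := psumr_eq0P (fun i _ => sqr_ge0 (x i 0)) s0.
by move=> /(_ i isT)/eqP; rewrite sqrf_eq0 => /eqP.
Qed.

Lemma pos_def1 : pos_def (1%:M : 'M[R]_d).
Proof. by split; [rewrite trmx1 | exact: qform1_gt0]. Qed.

Lemma pos_def_congr Q (A : 'M[R]_d) : A \in unitmx -> pos_def Q ->
  pos_def (A^T *m Q *m A).
Proof.
move=> uA [Qs Qp]; split; first by rewrite !trmx_mul trmxK Qs mulmxA.
move=> x x0; rewrite qform_congr; apply: Qp.
by apply: contra x0 => /eqP Ax0; rewrite -(mulKmx uA x) Ax0 mulmx0.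
Qed.

End Bilinear.

(** * Max norm estimates for matrices, then a trace bound for determinants *)

Lemma mx_entry_le (R : realType) (m n : nat) (A : 'M[R]_(m, n)) i j :
  `|A i j| <= `|A|.
Proof.
rewrite [leRHS]/Num.norm /= mx_normrE.
by apply/bigmax_geP; right; exists (i, j).
Qed.

Lemma mx_norm_le (R : realType) (m n : nat) (A : 'M[R]_(m, n)) (c : R) :
  0 <= c -> (forall i j, `|A i j| <= c) -> `|A| <= c.
Proof.
move=> c0 Ac; rewrite [leLHS]/Num.norm /= mx_normrE.
by apply/bigmax_leP; split => // -[i j] _; apply: Ac.
Qed.

Lemma dot_sym (R : realType) (d : nat) (x y : 'cV[R]_d) :
  (x^T *m y) 0 0 = (y^T *m x) 0 0.
Proof. by rewrite !mxE; apply: eq_bigr => i _; rewrite !mxE mulrC. Qed.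

Lemma sum_le_const (R : realType) (n : nat) (F : 'I_n -> R) (c : R) :
  (forall i, F i <= c) -> \sum_i F i <= n%:R * c.
Proof.
move=> Fc; apply: le_trans (ler_sum _ (fun i _ => Fc i)) _.
by rewrite sumr_const card_ord mulr_natl.
Qed.

Lemma mx_norm_mul (R : realType) (m n p : nat) (A : 'M[R]_(m, n))
    (B : 'M[R]_(n, p)) : `|A *m B| <= n%:R * (`|A| * `|B|).
Proof.
apply: mx_norm_le => [|i j]; first by rewrite !mulr_ge0.
rewrite mxE; apply: le_trans (ler_norm_sum _ _ _) _.
apply: sum_le_const => k.
by rewrite normrM ler_pM // mx_entry_le.
Qed.

Lemma mx_norm_tr (R : realType) (m n : nat) (A : 'M[R]_(m, n)) : `|A^T| <= `|A|.
Proof. by apply: mx_norm_le => // i j; rewrite mxE mx_entry_le. Qed.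

Lemma mx_trace_le (R : realType) (d : nat) (A : 'M[R]_d) :
  `|\tr A| <= d%:R * `|A|.
Proof.
apply: le_trans (ler_norm_sum _ _ _) _.
by apply: sum_le_const => k; apply: mx_entry_le.
Qed.

Lemma bform_le (R : realType) (d : nat) (Q : 'M[R]_d) x y :
  `|bform Q x y| <= d%:R ^+ 2 * (`|Q| * `|x| * `|y|).
Proof.
apply: le_trans (mx_entry_le _ _ _) _; apply: le_trans (mx_norm_mul _ _) _.
rewrite expr2 -!mulrA ler_wpM2l //.
rewrite !mulrA ler_wpM2r //; apply: le_trans (mx_norm_mul _ _) _.
rewrite -!mulrA ler_wpM2l // mulrC; apply: ler_wpM2l => //; exact: mx_norm_tr.
Qed.

Lemma norm_sqr_le_qform1 (R : realType) (d : nat) (x : 'cV[R]_d) :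
  `|x| ^+ 2 <= qform 1%:M x.
Proof.
rewrite -[leRHS]sqr_sqrtr ?qform1_ge0 // ler_pXn2r ?nnegrE ?sqrtr_ge0 //.
apply: mx_norm_le => [|i j]; first exact: sqrtr_ge0.
rewrite -sqrtr_sqr ler_sqrt ?qform1_ge0 // (ord1 j) qform1E.
by rewrite (bigD1 i) //= lerDl sumr_ge0 // => k _; apply: sqr_ge0.
Qed.

Lemma qform1_le_norm_sqr (R : realType) (d : nat) (x : 'cV[R]_d) :
  qform 1%:M x <= d%:R * `|x| ^+ 2.
Proof.
rewrite qform1E; apply: sum_le_const => i.
by rewrite -normr_id -real_normK ?num_real // ler_pXn2r ?nnegrE // normr_id mx_entry_le.
Qed.

(* Eliminating the first variable by a Schur complement [S], one has
   [det P = a * det S] and [tr P >= a + tr S], and [a <= exp (a - 1)]. *)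
Lemma pos_def_det (R : realType) (d : nat) (P : 'M[R]_d) : pos_def P ->
  [/\ 0 < \det P, \det P <= expR (\tr P - d%:R)
    & P <> 1%:M -> \det P < expR (\tr P - d%:R)].
Proof.
elim: d P => [|d IH] P [Ps Pp].
  rewrite det_mx00 /mxtrace big_ord0 subrr expR0; split => //.
  by case; rewrite [P]flatmx0 [RHS]flatmx0.
pose a := P 0 0; pose b : 'cV[R]_d := @dlsubmx R 1 d 1 d P.
pose P' : 'M[R]_d := @drsubmx R 1 d 1 d P.
have PE : P = @block_mx R 1 d 1 d a%:M b^T b P'.
  have -> : a%:M = @ulsubmx R 1 d 1 d P.
    by rewrite [RHS]mx11_scalar !mxE; congr ((P _ _)%:M); apply: val_inj.
  have -> : b^T = @ursubmx R 1 d 1 d P by rewrite /b trmx_dlsub Ps.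
  by rewrite submxK.
have P's : P'^T = P' by rewrite /P' trmx_drsub Ps.
have qP (u : R) (y : 'cV[R]_d) :
    qform P (@col_mx R 1 d 1 u%:M y) = a * u ^+ 2 + 2 * u * (b^T *m y) 0 0 + qform P' y.
  rewrite /qform PE (@tr_col_mx R 1 d 1) (@mul_row_block R 1 1 d 1 d) (@mul_row_col R 1 1 d 1).
  rewrite tr_scalar_mx !mulmxDl !mul_scalar_mx !mul_mx_scalar -!scalemxAl !mxE eqxx mulr1n.
  have := dot_sym y b; rewrite !mxE => ->.
  by ring.
have a0 : 0 < a.
  have := Pp (@col_mx R 1 d 1 1%:M 0);
    rewrite (qP 1 0) /qform !mulmx0 !mxE expr1n !mulr1 !mulr0 !addr0; apply.
  apply/eqP => /(congr1 (fun M : 'cV[R]_(1 + d) => M (lshift d 0) 0)).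
  by rewrite (@col_mxEu R 1 d 1) !mxE eqxx => /eqP; rewrite oner_eq0.
pose S := P' - a^-1 *: (b *m b^T).
have qS y : qform S y = qform P' y - a^-1 * (b^T *m y) 0 0 ^+ 2.
  rewrite /qform /S mulmxBr mulmxBl mxE; congr (_ + _).
  have e : (y^T *m (b *m b^T) *m y) 0 0 = (b^T *m y) 0 0 ^+ 2.
    by rewrite mulmxA -mulmxA mxE big_ord1 expr2 (dot_sym y b).
  by rewrite -scalemxAr -scalemxAl mxE [in LHS]mxE e.
have Sp : pos_def S.
  split; first by rewrite /S linearB linearZ /= trmx_mul trmxK P's.
  (* This [u] minimizes [a u^2 + 2 u (b^T y) + P'[y]], and the minimum is [S[y]]. *)
  move=> y y0; pose u := - a^-1 * (b^T *m y) 0 0.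
  have -> : qform S y = qform P (@col_mx R 1 d 1 u%:M y).
    by rewrite qP qS /u; field; rewrite gt_eqF.
  apply: Pp; apply: contra y0 => /eqP/(congr1 (@dsubmx R 1 d 1)).
  by rewrite (@col_mxKd R 1 d 1) => ->; apply/eqP/colP => i; rewrite !mxE.
have detP : \det P = a * \det S.
  have -> : P = @block_mx R 1 d 1 d 1%:M 0 (a^-1 *: b) 1%:M *m
                @block_mx R 1 d 1 d a%:M b^T 0 S.
    rewrite PE (@mulmx_block R 1 d 1 d 1 d) !mul1mx !mul0mx !addr0.
    rewrite mul_mx_scalar scalerA divff ?gt_eqF // scale1r /S.
    by rewrite -scalemxAl addrC subrK.
  by rewrite det_mulmx (@det_lblock R 1 d) (@det_ublock R 1 d) !det1 !mul1r det_scalar1.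
have trP : \tr P = a + \tr S + a^-1 * (b^T *m b) 0 0.
  rewrite PE (@mxtrace_block R 1 d) mxtrace_scalar mulr1n /S linearB linearZ /=.
  by rewrite mxtrace_mulC /(\tr (b^T *m b)) big_ord1; ring.
have [Sd Sle Slt] := IH S Sp.
have bb0 : 0 <= (b^T *m b) 0 0.
  by have := qform1_ge0 b; rewrite /qform mulmx1.
have abb0 : 0 <= a^-1 * (b^T *m b) 0 0 by rewrite mulr_ge0 // invr_ge0 ltW.
have aexp : a <= expR (a - 1).
  by have := expR_ge1Dx (a - 1); rewrite addrC subrK.
have eE : expR (\tr P - d.+1%:R)
    = expR (a - 1) * expR (\tr S - d%:R) * expR (a^-1 * (b^T *m b) 0 0).
  by rewrite -!expRD; congr expR; rewrite trP -natr1; ring.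
have e1 : 1 <= expR (a^-1 * (b^T *m b) 0 0).
  by rewrite -expR0 ler_expR.
have asle : a * \det S <= expR (a - 1) * expR (\tr S - d%:R).
  by rewrite ler_pM // ltW.
have epos : 0 < expR (a - 1) * expR (\tr S - d%:R) by rewrite mulr_gt0 ?expR_gt0.
split.
- by rewrite detP mulr_gt0.
- rewrite detP eE; apply: le_trans asle _.
  by rewrite ler_peMr // ltW.
- move=> P1; rewrite detP eE.
  (* The chain is strict as soon as one of [b = 0], [a = 1], [S = 1] fails, and all three together
     give [P = 1]. *)
  have [b0|b0] := eqVneq b 0; last first.
    have : 0 < qform 1%:M b by apply: qform1_gt0.
    rewrite /qform mulmx1 => bbp.
    apply: le_lt_trans asle _; rewrite ltr_pMr // expR_gt1.
    by rewrite mulr_gt0 // invr_gt0.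
  suff : a * \det S < expR (a - 1) * expR (\tr S - d%:R).
    by move=> /lt_le_trans; apply; rewrite ler_peMr // ltW.
  have [a1|a1] := eqVneq a 1.
    rewrite a1 subrr expR0 !mul1r; apply: Slt => S1; apply: P1.
    rewrite PE a1 b0 trmx0 (_ : P' = 1%:M); first by rewrite -(@scalar_mx_block R 1 d).
    by rewrite -S1 /S b0 mul0mx scaler0 subr0.
  apply: (@lt_le_trans _ _ (expR (a - 1) * \det S)).
    rewrite ltr_pM2r //; have := @expR_gt1Dx R (a - 1).
    by rewrite subr_eq0 addrC subrK; apply.
  by rewrite ler_wpM2l // ltW // expR_gt0.
Qed.

(** * Compactness of the unit sphere *)

Lemma mx_norm_vec_mx (R : realType) (m n : nat) (v : 'rV[R]_(m * n)) :
  `|vec_mx v| <= `|v|.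
Proof. by apply: mx_norm_le => // i j; rewrite mxE mx_entry_le. Qed.

Lemma mx_norm_mxvec (R : realType) (m n : nat) (A : 'M[R]_(m, n)) :
  `|mxvec A| <= `|A|.
Proof.
apply: mx_norm_le => // i j; rewrite (ord1 i).
by case/mxvec_indexP: j => a b; rewrite mxvecE mx_entry_le.
Qed.

(** Each point of the unit sphere has a neighbourhood on which a single [l i] stays below a fixed
    negative level. Compactness makes the level uniform, although [I] may be infinite and the
    constants [C] need not be bounded over [I]. Homogeneity extends the bound to all [x]. *)
Lemma linear_family_bound (R : realType) (p q : nat) (I : Type)
    (l : I -> 'M[R]_(p, q) -> R) :
  (forall i x y, l i (x - y) = l i x - l i y) ->
  (forall i a x, l i (a *: x) = a * l i x) ->
  (forall i, exists C, forall x, `|l i x| <= C * `|x|) ->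
  (forall x, x != 0 -> exists i, l i x < 0) ->
  exists2 c, 0 < c & forall x, x != 0 -> exists i, l i x <= - c * `|x|.
Proof.
move=> lB lZ lC lneg.
pose K := [set v : 'rV[R]_(p * q) | `|v| = 1].
have Kc : compact K.
  apply: bounded_closed_compact.
    exists 1; split; first exact: num_real.
    by move=> M M1 v /= v1; apply: le_trans (ltW M1); rewrite le_eqVlt; apply/orP;
      left; apply/eqP.
  rewrite (_ : K = Num.norm @^-1` [set 1]); last by apply/seteqP; split.
  by apply: closed_comp => [x _|]; [exact: norm_continuous | exact: closed_eq].
have Kv (v : 'rV[R]_(p * q)) : K v -> vec_mx v != 0.
  move=> v1; apply/eqP => v0.
  have : v = 0 by rewrite -[v]vec_mxK v0 linear0.
  by move=> v00; move: v1; rewrite /K /= v00 normr0 => /esym/eqP; rewrite oner_eq0.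
have := Kc; rewrite compact_near_coveringP.
move=> /(_ R (0^'+) (fun e v => exists i, l i (vec_mx v) < - e)).
have step : forall x, K x ->
    \forall x' \near x & e \near 0^'+, exists i, l i (vec_mx x') < - e.
  move=> v /Kv/lneg[i li].
  have [C hC] := lC i.
  (* Here [l i (vec_mx v) = - 2 a]; moving [v] by less than [a / C'] changes the value by less than
     [a], so it remains below [- a], hence below [- e] when [e < a]. *)
  pose a := - l i (vec_mx v) / 2.
  have a0 : 0 < a by rewrite divr_gt0 // oppr_gt0.
  pose C' := `|C| + 1; have C'0 : 0 < C' by rewrite /C' ltr_wpDl.
  have hC' x : `|l i x| <= C' * `|x|.
    apply: le_trans (hC x) _; rewrite ler_wpM2r // /C'.
    by rewrite (le_trans (ler_norm C)) // lerDl.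
  exists ([set v' | `|v - v'| < a / C'], [set e | e < a]) => /=.
    split; last exact: nbhs_right_lt.
    by rewrite -nbhs_nbhs_norm; exists (a / C') => //=; apply: divr_gt0.
  move=> [v' e] /= [v'v ea]; exists i.
  have : `|l i (vec_mx (v' - v))| < a.
    apply: le_lt_trans (hC' _) _.
    rewrite mulrC -ltr_pdivlMr //; apply: le_lt_trans (mx_norm_vec_mx _) _.
    by rewrite distrC.
  rewrite linearB lB ltr_norml => /andP[_].
  by move: ea; rewrite /a; lra.
move=> /(_ _ step) nr.
have : \forall e \near (0 : R)^'+, 0 < e /\
    K `<=` (fun v => exists i, l i (vec_mx v) < - e).
  by near=> e; split; near: e => //; exact: nbhs_right_gt.
move=> /filter_ex[c [c0 Kb]]; exists c => // x x0.
have nx0 : 0 < `|x| by rewrite normr_gt0.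
pose y := `|x|^-1 *: x.
have ny : `|y| = 1 by rewrite normrZ normfV normr_id mulVf ?gt_eqF.
have /Kb[i] : K (mxvec y).
  apply/eqP; rewrite eq_le -{1}ny mx_norm_mxvec /=.
  by rewrite -ny -{1}(mxvecK y) mx_norm_vec_mx.
rewrite mxvecK lZ => h; exists i.
by rewrite ltW // -ltr_pdivrMr // mulrC.
Unshelve. all: by end_near. Qed.

(** * Difference vectors, and the minimum [lambda] along a line of periodic forms *)

Definition diff_vec (R : realType) (d n : nat) (t : 'M[R]_(d, n))
    (i j : 'I_n.+1) (v : 'cV[int]_d) : 'cV[R]_d :=
  transl t i - transl t j - map_mx intr v.

Definition admissible (d n : nat) (i j : 'I_n.+1) (v : 'cV[int]_d) : Prop :=
  i = j -> v != 0.

Lemma lambda_le (R : realType) (d n : nat) (X : 'M[R]_d * 'M[R]_(d, n)) i j v :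
  (forall x, 0 <= qform X.1 x) -> admissible i j v ->
  lambda X <= qform X.1 (diff_vec X.2 i j v).
Proof.
move=> X0 ijv; apply: ge_inf; last by exists i, j, v.
by exists 0 => _ [i' [j' [v' [_ ->]]]]; apply: X0.
Qed.

Lemma lambda_ge (R : realType) (d n : nat) (X : 'M[R]_d * 'M[R]_(d, n)) c :
  (0 < d)%N ->
  (forall i j v, admissible i j v -> c <= qform X.1 (diff_vec X.2 i j v)) ->
  c <= lambda X.
Proof.
move=> d0 cX; apply: lb_le_inf.
  (* The set is nonempty because [0 < d] makes the all-ones vector nonzero. *)
  exists (qform X.1 (diff_vec X.2 0 0 (const_mx 1))); exists 0, 0, (const_mx 1).
  split=> // _; apply/eqP => /colP/(_ (Ordinal d0)).
  by rewrite !mxE => /eqP; rewrite oner_eq0.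
by move=> _ [i [j [v [ijv ->]]]]; apply: cX.
Qed.

Lemma pos_def_ge0 (R : realType) (d : nat) (Q : 'M[R]_d) x :
  pos_def Q -> 0 <= qform Q x.
Proof.
move=> [_ Qp]; have [->|x0] := eqVneq x 0; first by rewrite qformE bform0l.
exact/ltW/Qp.
Qed.

Lemma translD (R : realType) (d n : nat) (t s : 'M[R]_(d, n)) i :
  transl (t + s) i = transl t i + transl s i.
Proof.
by rewrite /transl; case: unliftP => [j _|_]; [rewrite linearD | rewrite addr0].
Qed.

Lemma translZ (R : realType) (d n : nat) a (t : 'M[R]_(d, n)) i :
  transl (a *: t) i = a *: transl t i.
Proof.
by rewrite /transl; case: unliftP => [j _|_]; [rewrite linearZ | rewrite scaler0].
Qed.

Lemma transl_norm (R : realType) (d n : nat) (t : 'M[R]_(d, n)) i :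
  `|transl t i| <= `|t|.
Proof.
rewrite /transl; case: unliftP => [j _|_]; last by rewrite normr0.
by apply: mx_norm_le => // a b; rewrite mxE mx_entry_le.
Qed.

Definition rel_shift (R : realType) (d n : nat) (s : 'M[R]_(d, n)) (i j : 'I_n.+1) :=
  transl s i - transl s j.

Lemma rel_shift_norm (R : realType) (d n : nat) (t : 'M[R]_(d, n)) i j :
  `|rel_shift t i j| <= 2 * `|t|.
Proof.
apply: le_trans (ler_normB _ _) _.
by have := transl_norm t i; have := transl_norm t j; lra.
Qed.

Lemma diff_vecD (R : realType) (d n : nat) (t s : 'M[R]_(d, n)) i j v :
  diff_vec (t + s) i j v = diff_vec t i j v + rel_shift s i j.
Proof. by rewrite /diff_vec /rel_shift !translD; apply/colP => k; rewrite !mxE;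
  ring. Qed.

Lemma rel_shiftZ (R : realType) (d n : nat) a (s : 'M[R]_(d, n)) i j :
  rel_shift (a *: s) i j = a *: rel_shift s i j.
Proof. by rewrite /rel_shift !translZ scalerBr. Qed.

Lemma rel_shiftB (R : realType) (d n : nat) (s s' : 'M[R]_(d, n)) i j :
  rel_shift (s - s') i j = rel_shift s i j - rel_shift s' i j.
Proof.
rewrite /rel_shift !translD -scaleN1r !translZ.
by apply/colP => k; rewrite !mxE; ring.
Qed.

(** For a fixed triple [i, j, v], the value of the form along a line in parameter space is a cubic
    in the parameter: linear through the matrix, quadratic through the vector. This handles the
    triples that start strictly above the minimum. *)
Lemma cubic_ge_near0 (R : realType) (m a0 a1 a2 a3 : R) : m < a0 ->
  exists2 e, 0 < e & forall t, 0 <= t <= e ->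
    m <= a0 + t * a1 + t ^+ 2 * a2 + t ^+ 3 * a3.
Proof.
move=> ma0; pose M := `|a1| + `|a2| + `|a3| + 1.
have M0 : 0 < M by rewrite /M ltr_wpDl // !addr_ge0.
exists (Num.min 1 ((a0 - m) / M)).
  by rewrite lt_min ltr01 divr_gt0 // subr_gt0.
move=> t /andP[t0]; rewrite le_min => /andP[t1]; rewrite ler_pdivlMr // => tM.
have h k b : (0 < k)%N -> - (t * `|b|) <= t ^+ k * b.
  move=> k0; rewrite lerNl -mulrN.
  have tk : t ^+ k <= t.
    case: k k0 => // k _; rewrite exprS ler_piMr //; exact: exprn_ile1.
  apply: le_trans (_ : t ^+ k * `|b| <= _).
    by rewrite ler_wpM2l ?exprn_ge0 // -normrN ler_norm.
  exact: ler_wpM2r.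
have := h 1%N a1 isT; have := h 2%N a2 isT; have := h 3%N a3 isT.
rewrite expr1; move: tM; rewrite /M !mulrDr mulr1; lra.
Qed.

Lemma fin_common_radius (R : realType) (T : finType) (P : T -> R -> Prop) :
  (forall x, exists2 e, 0 < e & forall t, 0 <= t <= e -> P x t) ->
  exists2 e, 0 < e & forall t, 0 <= t <= e -> forall x, P x t.
Proof.
move=> h; have h' x : exists e, 0 < e /\ forall t, 0 <= t <= e -> P x t.
  by have [e e0 he] := h x; exists e.
have [f hf] := choice h'.
exists (\big[Num.min/1]_x f x).
  by apply: lt_bigmin => // x _; case: (hf x).
move=> t /andP[t0 te] x; apply: (hf x).2; rewrite t0 (le_trans te) //.
exact: bigmin_le_cond.
Qed.

(** From [x = A^-1 (A x)] one gets [|x| <= k |A x|]. The constant uses [1 + k ^+ 2] so that [k = 0]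
    causes no division by zero. *)
Lemma coercive_unit (R : realType) (d : nat) (A : 'M[R]_d) : A \in unitmx ->
  exists2 c, 0 < c & forall x, c * `|x| ^+ 2 <= qform (A^T *m A) x.
Proof.
move=> uA; pose k := d%:R * `|invmx A|.
have k0 : 0 <= k by rewrite mulr_ge0.
exists (1 + k ^+ 2)^-1; first by rewrite invr_gt0 ltr_pwDl // sqr_ge0.
move=> x; rewrite mulrC ler_pdivrMr; last by rewrite ltr_pwDl // sqr_ge0.
have -> : qform (A^T *m A) x = qform 1%:M (A *m x).
  by rewrite -qform_congr mulmx1.
have h : `|x| <= k * `|A *m x|.
  by rewrite -{1}(mulKmx uA x) -mulrA; apply: mx_norm_mul.
apply: (@le_trans _ _ (k ^+ 2 * qform 1%:M (A *m x))).
  apply: (@le_trans _ _ (k ^+ 2 * `|A *m x| ^+ 2)).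
    by rewrite -exprMn ler_pXn2r ?nnegrE ?mulr_ge0.
  by rewrite ler_wpM2l ?sqr_ge0 // norm_sqr_le_qform1.
rewrite mulrC ler_wpM2l ?qform1_ge0 //; lra.
Qed.

(** Parametrizes the integer vectors with entries in [[- N, N]] by a finite type, so that
    [fin_common_radius] applies to them. *)
Definition int_box (d N : nat) (f : {ffun 'I_d -> 'I_(N + N).+1}) : 'cV[int]_d :=
  \col_k ((f k : nat)%:Z - N%:Z).

Lemma int_boxP (d N : nat) (v : 'cV[int]_d) :
  (exists f : {ffun 'I_d -> 'I_(N + N).+1}, v = int_box f) \/
  exists k, (N < absz (v k ord0))%N.
Proof.
have [/forallP small|/forallPn[k]] := boolP [forall k, (absz (v k ord0) <= N)%N].
  left; exists [ffun k => inord (absz (v k ord0 + N%:Z))].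
  apply/colP => k; rewrite mxE ffunE; have := small k; move: (v k ord0) => z zN.
  rewrite inordK; lia.
by rewrite -ltnNge => h; right; exists k.
Qed.

(* Triples with a large integer part stay above the minimum by coercivity; the
   finitely many others are handled one at a time. *)
Lemma lambda_ge_line (R : realType) (d n : nat) (X : 'M[R]_d * 'M[R]_(d, n))
    (c : R) (H : 'M[R]_d) (s : 'M[R]_(d, n)) :
  (0 < d)%N -> 0 < c -> (forall x, c * `|x| ^+ 2 <= qform X.1 x) ->
  (forall i j v, admissible i j v ->
     qform X.1 (diff_vec X.2 i j v) = lambda X -> forall e, 0 <= e ->
     lambda X <= qform (X.1 + e *: H) (diff_vec (X.2 + e *: s) i j v)) ->
  exists2 e0, 0 < e0 & forall e, 0 <= e <= e0 ->
    lambda X <= lambda (X.1 + e *: H, X.2 + e *: s).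
Proof.
case: X => Q t /= d0 c0 Qc; set mu := lambda _ => hmin.
have Q0 x : 0 <= qform Q x.
  by apply: le_trans (Qc x); rewrite mulr_ge0 ?sqr_ge0 // ltW.
pose T := 2 * `|t| + 2 * `|s|.
(* Outside the box of size [N > b], and for [e <= 1], the difference vector [y] satisfies
   [|y| >= N - T], hence [|y| >= 1] and [|y| >= 2 |mu| / c]; so half of the coercive term,
   [c / 2 |y|^2], already reaches [mu]. *)
pose b := T + 1 + 2 * `|mu| / c.
have b0 : 0 <= b.
  by rewrite /b /T !addr_ge0 ?mulr_ge0 ?invr_ge0 // ltW.
pose N := Num.bound b.
have bN : b < N%:R by have := archi_boundP b0.
pose P (x : 'I_n.+1 * 'I_n.+1 * {ffun 'I_d -> 'I_(N + N).+1}) e :=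
  admissible x.1.1 x.1.2 (int_box x.2) ->
  mu <= qform (Q + e *: H) (diff_vec (t + e *: s) x.1.1 x.1.2 (int_box x.2)).
have [e1 e10 he1] : exists2 e, 0 < e & forall u, 0 <= u <= e -> forall x, P x u.
  apply: fin_common_radius => -[[i j] f]; rewrite /P /=; set v := int_box f.
  have [adm|nadm] := pselect (admissible i j v); last by exists 1 => // u _ /nadm.
  have [eqm|neqm] := eqVneq (qform Q (diff_vec t i j v)) mu.
    by exists 1 => // u /andP[u0 _] _; apply: hmin.
  have ltm : mu < qform Q (diff_vec t i j v).
    by rewrite lt_neqAle eq_sym neqm /=; apply: (@lambda_le _ _ _ (Q, t)).
  set x := diff_vec t i j v in ltm *.
  pose w := rel_shift s i j.
  have [e e0 he] := cubic_ge_near0 (bform Q x w + bform Q w x + bform H x x)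
    (bform Q w w + bform H x w + bform H w x) (bform H w w) ltm.
  exists e => // u /he h _; apply: le_trans h _.
  rewrite le_eqVlt; apply/orP; left; apply/eqP.
  rewrite diff_vecD rel_shiftZ -/x -/w.
  rewrite {he ltm neqm}; move: x w => x w;
    rewrite qform_mxD qform_mxZ !qformE !bformDl !bformDr.
  rewrite !bformZl !bformZr; ring.
(* For [e <= e2] the term [e H[y]] costs at most the other half of the coercive term. *)
pose e2 := c / (2 * (d%:R ^+ 2 * `|H| + 1)).
have p0 : 0 < 2 * (d%:R ^+ 2 * `|H| + 1) :> R.
  by rewrite mulr_gt0 // ltr_wpDl // mulr_ge0 ?sqr_ge0.
have e20 : 0 < e2 by rewrite divr_gt0.
exists (Num.min 1 (Num.min e1 e2)); first by rewrite !lt_min ltr01 e10.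
move=> e /andP[e0]; rewrite !le_min => /andP[el1] /andP[ele1 ele2].
apply: lambda_ge => // i j v adm /=.
have [[f vf]|[k vk]] := int_boxP N v.
  by have := he1 e _ (i, j, f); rewrite /P /= -vf; apply => //; rewrite e0.
set y := diff_vec _ i j v.
have yk : N%:R - T <= `|y|.
  have vy : map_mx intr v = rel_shift t i j + e *: rel_shift s i j - y.
    by rewrite /y diff_vecD rel_shiftZ /diff_vec -/(rel_shift t i j) opprD opprB addrACA subrr addr0 addrC subrK.
  have : N%:R <= `|(map_mx intr v : 'cV[R]_d)|.
    apply: le_trans (mx_entry_le _ k ord0); rewrite mxE -intr_norm.
    rewrite (_ : N%:R = (N%:Z)%:~R) // ler_int; lia.
  rewrite vy => Nle; rewrite lerBlDr; apply: le_trans Nle _.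
  apply: le_trans (ler_normB _ _) _.
  have := ler_normD (rel_shift t i j) (e *: rel_shift s i j).
  rewrite normrZ (ger0_norm e0).
  have := rel_shift_norm t i j; have := rel_shift_norm s i j.
  have : e * `|rel_shift s i j| <= `|rel_shift s i j| by rewrite ler_piMl.
  by rewrite /T; lra.
have m0 : 0 <= 2 * `|mu| / c by rewrite !mulr_ge0 ?invr_ge0 // ltW.
have y1 : 1 <= `|y| by apply: le_trans yk; move: bN; rewrite /b; lra.
have ymu : `|mu| <= c / 2 * `|y|.
  have : 2 * `|mu| / c <= `|y| by apply: le_trans yk; move: bN; rewrite /b; lra.
  by rewrite ler_pdivrMr //; lra.
apply: le_trans (ler_norm _) _; apply: le_trans ymu _.
apply: (@le_trans _ _ (c / 2 * `|y| ^+ 2)).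
  by apply: ler_wpM2l; [rewrite divr_ge0 // ltW | rewrite expr2 ler_peMr].
rewrite qform_mxD qform_mxZ.
have hH : - (c / 2 * `|y| ^+ 2) <= e * qform H y.
  rewrite lerNl -mulrN; apply: (@le_trans _ _ (e * (d%:R ^+ 2 * (`|H| * `|y| * `|y|)))).
    by rewrite ler_wpM2l // (le_trans _ (bform_le H y y)) // -normrN ler_norm.
  have -> : e * (d%:R ^+ 2 * (`|H| * `|y| * `|y|)) = e * (d%:R ^+ 2 * `|H|) * `|y| ^+ 2 by ring.
  apply: ler_wpM2r; first exact: sqr_ge0.
  move: ele2; rewrite /e2 ler_pdivlMr //; move: e0; set h := _ * `|H|; nra.
have := Qc y; lra.
Qed.

(** * Positivity of the volume of the unit ball *)

(** The integral of a nonnegative function is a supremum over the simple functions below it, so it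
    is monotone without measurability; the volumes of sections can thus be compared directly. *)
Lemma le_integral_nonneg (d : measure_display) (T : measurableType d) (R : realType)
    (mu : {measure set T -> \bar R}) (f g : T -> \bar R) :
  (forall x, 0 <= f x)%E -> (forall x, f x <= g x)%E ->
  (\int[mu]_x f x <= \int[mu]_x g x)%E.
Proof.
move=> f0 fg; rewrite !ge0_integralTE //; last first.
  by move=> x; apply: le_trans (fg x).
by apply: ereal_sup_le => _ [h hf <-]; exists h => // x; apply: le_trans (fg x).
Qed.

Section Volume.
Variable R : realType.

Lemma volume_ge0 (n : nat) (A : set 'cV[R]_n) : (0 <= volume A)%E.
Proof.
elim: n A => [|n IH] A /=; first by rewrite lee_fin indicE.
by apply: integral_ge0 => x _; apply: IH.
Qed.

Lemma le_volume (n : nat) (A B : set 'cV[R]_n) :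
  A `<=` B -> (volume A <= volume B)%E.
Proof.
elim: n A B => [|n IH] A B AB /=.
  rewrite lee_fin !indicE ler_nat; have [|] := boolP (_ \in A) => // /set_mem/AB.
  by move=> /mem_set ->.
apply: le_integral_nonneg => x; first exact: volume_ge0.
by apply: IH => y /AB.
Qed.

Lemma volume0 (n : nat) : volume (set0 : set 'cV[R]_n) = 0%E.
Proof.
elim: n => [|n IH] /=; first by rewrite indic0.
by rewrite integral0_eq // => x _; rewrite -[RHS]IH; congr volume; apply/seteqP; split.
Qed.

Lemma volume_cube (n : nat) (a : R) : 0 < a ->
  volume [set x : 'cV[R]_n | forall i, `|x i 0| <= a] = ((2 * a) ^+ n)%:E.
Proof.
move=> a0; elim: n => [|n IH] /=.
  by rewrite expr0 indicE mem_set // => -[].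
pose I : set R := `[- a, a]%classic; pose c : \bar R := ((2 * a) ^+ n)%:E.
transitivity (\int[@lebesgue_measure R]_(x in I) cst c x)%E; rewrite /I /c.
  rewrite [RHS]integral_mkcond; apply: eq_integral => x _.
  rewrite patchE; case: ifPn => [|].
    rewrite inE /= in_itv /= -ler_norml => xa; rewrite -[RHS]IH; congr volume.
    apply/seteqP; split => y /= h i; first by have /= := h (rshift 1 i);
      rewrite (@col_mxEd R 1 n 1).
    by case: (@split_ordP 1 n i) => j -> /=;
      rewrite ?(@col_mxEu R 1 n 1) ?(@col_mxEd R 1 n 1) // (ord1 j) mxE eqxx.
  move=> /negP; rewrite inE /= in_itv /= -ler_norml => xa.
  rewrite -[RHS](volume0 n); congr volume; apply/seteqP; split => y //= h.
  by apply: xa; have /= := h (@lshift 1 n 0); rewrite (@col_mxEu R 1 n 1) mxE eqxx.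
rewrite integral_cst // [X in (_ * X)%E]lebesgue_measure_itv /= lte_fin.
rewrite ifT; last by lra.
by rewrite -EFinB -EFinM exprSr; congr (_ * _)%:E; ring.
Qed.

(** The ball lies between two cubes. The inner one makes its volume positive; the outer one makes it
    finite, which matters because [fine] sends infinity to 0. *)
Lemma unit_ball_volume_gt0 (d : nat) : 0 < unit_ball_volume R d.
Proof.
rewrite /unit_ball_volume; set B := [set x : 'cV[R]_d | _].
have Bsub : B `<=` [set x : 'cV[R]_d | forall i, `|x i 0| <= 1].
  move=> x x1 i; apply: le_trans (mx_entry_le x i 0) _.
  have h : qform 1%:M x <= 1.
    rewrite -[leLHS]sqr_sqrtr ?qform1_ge0 // exprn_ile1 ?sqrtr_ge0 //.
    by move: x1; rewrite /B /= /enorm /qform mulmx1.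
  rewrite -(@expr_le1 _ 2) //; exact: le_trans (norm_sqr_le_qform1 x) h.
(* With this half-side, [d a^2 <= (d + 1) a^2 = a <= 1]; the successor also covers [d = 0]. *)
pose a : R := d.+1%:R^-1.
have a0 : 0 < a by rewrite invr_gt0 ltr0n.
have subB : [set x : 'cV[R]_d | forall i, `|x i 0| <= a] `<=` B.
  move=> x xa; rewrite /B /= /enorm -[X in _ <= X]sqrtr1 ler_sqrt //.
  have xa' : `|x| <= a.
    by apply: mx_norm_le => [|i j]; [exact: ltW | rewrite (ord1 j)].
  have := qform1_le_norm_sqr x; rewrite {1}/qform mulmx1 => h; apply: le_trans h _.
  apply: (@le_trans _ _ (d.+1%:R * a ^+ 2)).
    by rewrite ler_pM ?sqr_ge0 ?ler_nat // ler_pXn2r ?nnegrE // ltW.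
  rewrite expr2 mulrA divff ?mul1r ?pnatr_eq0 // invf_le1 ?ltr0n //.
  by rewrite ler1n.
have := le_volume Bsub; have := le_volume subB.
rewrite !volume_cube // mulr1 => lo hi.
have fB : volume B \is a fin_num.
  rewrite fin_numE; apply/andP; split.
    by apply/eqP => BE; have := volume_ge0 B; rewrite BE.
  by apply/eqP => BE; move: hi; rewrite BE.
rewrite -lte_fin fineK //; apply: lt_le_trans lo.
by rewrite lte_fin exprn_gt0 // mulr_gt0.
Qed.

End Volume.

(** * Monotonicity of the density in [lambda] and in the determinant *)

Section Density.
Variables (R : realType) (d n : nat).
Implicit Types X Y : 'M[R]_d * 'M[R]_(d, n).
Hypothesis d0 : (0 < d)%N.

Let base_ge0 X : 0 <= lambda X -> 0 <= lambda X / (\det X.1) `^ (d%:R^-1).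
Proof. by move=> l0; rewrite divr_ge0 // powR_ge0. Qed.

Lemma delta_le X Y : 0 <= lambda X -> lambda X <= lambda Y ->
  0 < \det Y.1 -> \det Y.1 <= \det X.1 -> delta X <= delta Y.
Proof.
move=> lX XY dY YX; rewrite /delta.
have dX := lt_le_trans dY YX.
have uv := unit_ball_volume_gt0 R d.
do 3!(apply: ler_wpM2r; first by rewrite ?invr_ge0 ?exprn_ge0 // ltW).
have lY := le_trans lX XY.
apply: ge0_ler_powR; rewrite ?nnegrE;
  [exact: divr_ge0 | exact: base_ge0 | exact: base_ge0 |].
apply: ler_pM => //; first by rewrite invr_ge0 powR_ge0.
rewrite lef_pV2 ?posrE ?powR_gt0 //.
by apply: ge0_ler_powR; rewrite ?nnegrE ?invr_ge0 // ltW.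
Qed.

Lemma delta_lt X Y : 0 < lambda X -> lambda X <= lambda Y ->
  0 < \det Y.1 -> \det Y.1 < \det X.1 -> delta X < delta Y.
Proof.
move=> lX XY dY YX; rewrite /delta.
have dX := lt_trans dY YX.
have uv := unit_ball_volume_gt0 R d.
have dR : 0 < d%:R :> R by rewrite ltr0n.
rewrite !ltr_pM2r ?invr_gt0 ?exprn_gt0 ?ltr0n //.
have lY := lt_le_trans lX XY.
apply: gt0_ltr_powR; rewrite ?nnegrE;
  [exact: divr_gt0 | exact/base_ge0/ltW | exact/base_ge0/ltW |].
apply: (@lt_le_trans _ _ (lambda X / \det Y.1 `^ d%:R^-1)).
  rewrite ltr_pM2l // ltf_pV2 ?posrE ?powR_gt0 //.
  by apply: gt0_ltr_powR; rewrite ?invr_gt0 ?nnegrE // ltW.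
by apply: ler_wpM2r => //; rewrite invr_ge0 powR_ge0.
Qed.

End Density.

(** * Euclidean isometries are affine *)

Lemma bform_delta (R : realType) (d : nat) (Q : 'M[R]_d) i j :
  bform Q (delta_mx i 0) (delta_mx j 0) = Q i j.
Proof. by rewrite /bform trmx_delta -rowE -colE !mxE. Qed.

Lemma cV_sum_delta (R : realType) (d : nat) (x : 'cV[R]_d) :
  x = \sum_i x i 0 *: delta_mx i 0.
Proof.
rewrite [LHS]matrix_sum_delta; apply: eq_bigr => i _.
by rewrite big_ord1.
Qed.

(** By polarization [g = f - f 0] preserves inner products. If [U] has the images of the standard
    basis as columns, then [<g x, U x> = |U x|^2 = |x|^2], whence [|g x - U x|^2 = 0]. *)
Lemma isometry_affine (R : realType) (d : nat) (f : 'cV[R]_d -> 'cV[R]_d) :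
  Defs.isometry f ->
  exists2 U : 'M[R]_d, U^T *m U = 1%:M & forall x, f x = f 0 + U *m x.
Proof.
move=> isof; pose b := @bform R d 1%:M.
have s1 : (1%:M : 'M[R]_d)^T = 1%:M by rewrite trmx1.
have qE (x : 'cV[R]_d) : qform 1%:M x = enorm x ^+ 2.
  by have := qform1_ge0 x; rewrite /enorm /qform mulmx1 => x0; rewrite sqr_sqrtr.
have [g gE] : exists g, forall x, g x = f x - f 0 by exists (fun x => f x - f 0).
have qg x y : qform 1%:M (g x - g y) = qform 1%:M (x - y).
  by rewrite !gE opprB addrA subrK !qE isof.
have g0 : g 0 = 0 by rewrite gE subrr.
have qg0 x : qform 1%:M (g x) = qform 1%:M x.
  by have := qg x 0; rewrite g0 !subr0.
have bg x y : b (g x) (g y) = b x y.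
  by have := qg x y; rewrite !qformB // !qg0 /b; lra.
pose U : 'M[R]_d := \matrix_(i, j) g (delta_mx j 0) i 0.
have OE y : U *m y = \sum_j y j 0 *: g (delta_mx j 0).
  apply/colP => i; rewrite !mxE summxE; apply: eq_bigr => j _.
  by rewrite !mxE mulrC.
have bgO x y : b (g x) (U *m y) = b x y.
  rewrite OE {2}[y]cV_sum_delta /b !bform_sumr; apply: eq_bigr => j _.
  by rewrite !bformZr [bform _ (g x) _]bg.
have bOO x y : b (U *m x) (U *m y) = b x y.
  rewrite (OE x) {2}[x]cV_sum_delta /b !bform_suml; apply: eq_bigr => j _.
  by rewrite !bformZl [bform _ (g _) _]bgO.
exists U.
  apply/matrixP => i j; have := bOO (delta_mx i 0) (delta_mx j 0).
  by rewrite /b -bform_congr mulmx1 !bform_delta.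
move=> x; suff : g x = U *m x by rewrite gE => <-; rewrite addrC subrK.
apply/eqP; rewrite -subr_eq0; apply/negPn/negP => /qform1_gt0.
have e1 : bform 1%:M (g x) (U *m x) = qform 1%:M x := bgO x x.
have e2 : qform 1%:M (U *m x) = qform 1%:M x := bOO x x.
by rewrite qformB // qg0 e2 e1; lra.
Qed.

(** * Representations of a lattice and its minimal vectors *)

Definition subgroup (R : realType) (d : nat) (L : set 'cV[R]_d) : Prop :=
  L 0 /\ forall x y, L x -> L y -> L (x - y).

Lemma subgroupD (R : realType) (d : nat) (L : set 'cV[R]_d) x y :
  subgroup L -> L x -> L y -> L (x + y).
Proof.
move=> [L0 LB] Lx Ly; rewrite -[y]opprK; apply: (LB) => //.
by rewrite -[- y]add0r; apply: LB.
Qed.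

(** A representation whose isometry has been absorbed into [A]. *)
Definition lattice_frame (R : realType) (d n : nat) (A : 'M[R]_d)
    (X : 'M[R]_d * 'M[R]_(d, n)) (L : set 'cV[R]_d) : Prop :=
  [/\ A \in unitmx, A^T *m A = X.1, trivIset setT (translate X.2)
    & L = mulmx A @` \bigcup_i translate X.2 i].

Lemma transl_max (R : realType) (d n : nat) (t : 'M[R]_(d, n)) :
  transl t ord_max = 0.
Proof. by rewrite /transl unlift_none. Qed.

Lemma translateP (R : realType) (d n : nat) (t : 'M[R]_(d, n)) i
    (v : 'cV[int]_d) : translate t i (transl t i + map_mx intr v).
Proof. by exists (map_mx intr v) => //; exists v. Qed.

Lemma represents_frame (R : realType) (d n : nat)
    (X : 'M[R]_d * 'M[R]_(d, n)) (L : set 'cV[R]_d) :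
  subgroup L -> represents X L -> exists A, lattice_frame A X L.
Proof.
move=> sL [_ tX [A [f [uA AX isof LE]]]].
have [U O1 fO] := isometry_affine isof.
set Lam := \bigcup_i translate X.2 i in LE.
have Lam0 : Lam 0.
  exists ord_max => //; have := translateP X.2 ord_max 0.
  by rewrite transl_max map_mx0 addr0.
have Lf x : Lam x -> L (f (A *m x)).
  by move=> Lx; rewrite LE; exists (A *m x) => //; exists x.
have Lf0 : L (f 0) by have := Lf _ Lam0; rewrite mulmx0.
exists (U *m A); split => //.
- by rewrite unitmx_mul uA andbT; have [] := mulmx1_unit O1.
- by rewrite trmx_mul mulmxA -(mulmxA A^T) O1 mulmx1.
apply/seteqP; split => [l Ll|_ [x Lx <-]].
  have := subgroupD sL Ll Lf0; rewrite {1}LE => -[_ [x Lx <-]].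
  rewrite fO addrC => /addIr xl; exists x => //.
  by rewrite -mulmxA.
have -> : U *m A *m x = f (A *m x) - f 0 by rewrite fO addrC addKr mulmxA.
by apply: sL.2 => //; apply: Lf.
Qed.

Lemma basis_frame (R : realType) (d : nat) (A : 'M[R]_d) (L : set 'cV[R]_d) :
  A \in unitmx -> L = mulmx A @` int_points R d ->
  lattice_frame A (A^T *m A, 0 : 'M[R]_(d, 0)) L.
Proof.
move=> uA LE; split => //=; first by move=> i j _ _ _; rewrite (ord1 i) (ord1 j).
rewrite LE; congr (mulmx A @` _); apply/seteqP; split => [x zx|x [i _ [z zz <-]]].
  exists ord_max => //; exists x => //.
  by rewrite transl_max add0r.
by rewrite (ord1 i) (_ : 0 = ord_max) ?transl_max ?add0r //; apply: val_inj.
Qed.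

Section Frame.
Variables (R : realType) (d n : nat) (A : 'M[R]_d).
Variables (X : 'M[R]_d * 'M[R]_(d, n)) (L : set 'cV[R]_d).
Hypotheses (sL : subgroup L) (fA : lattice_frame A X L).

Lemma frame_pos_def : pos_def X.1.
Proof.
case: fA => uA <- _ _.
by have := pos_def_congr uA (pos_def1 R d); rewrite mulmx1.
Qed.

Lemma frame_qform x : qform X.1 x = qform 1%:M (A *m x).
Proof. by case: fA => _ <- _ _; rewrite -qform_congr mulmx1. Qed.

Lemma transl_inj i j (v : 'cV[int]_d) :
  transl X.2 i - transl X.2 j = map_mx intr v -> i = j.
Proof.
move=> ij; case: fA => _ _ tX _; apply: tX => //; exists (transl X.2 i); split.
  by have := translateP X.2 i 0; rewrite map_mx0 addr0.
by have := translateP X.2 j v; rewrite -ij addrC subrK.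
Qed.

Lemma frame_translate i v : L (A *m (transl X.2 i + map_mx intr v)).
Proof.
case: fA => _ _ _ ->; exists (transl X.2 i + map_mx intr v) => //.
by exists i => //; apply: translateP.
Qed.

(** Differences stay in the group [L]. A zero difference would make [t_i - t_j] integral, so [i = j]
    by disjointness, and then [v = 0], which admissibility excludes. *)
Lemma frame_diff i j v : admissible i j v ->
  L (A *m diff_vec X.2 i j v) /\ A *m diff_vec X.2 i j v != 0.
Proof.
move=> adm; split.
  have h k : L (A *m transl X.2 k).
    by have := frame_translate k 0; rewrite map_mx0 addr0.
  have hv : L (A *m map_mx intr v).
    by have := frame_translate ord_max v; rewrite transl_max add0r.
  by rewrite /diff_vec !mulmxBr; do 2!apply: sL.2 => //.
case: (fA) => uA _ _ _; apply/eqP => A0.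
have {A0} : diff_vec X.2 i j v = 0 by rewrite -(mulKmx uA (diff_vec _ _ _ _)) A0 mulmx0.
move=> /eqP; rewrite subr_eq0 => /eqP ij.
have e := transl_inj ij; have := adm e; move: ij; rewrite e subrr => /esym v0.
move=> /eqP; apply; apply/matrixP => a c; rewrite !mxE.
move/matrixP: v0 => /(_ a c); rewrite !mxE => /eqP; rewrite intr_eq0.
by move=> /eqP.
Qed.

(** As [L] is a group, [A t_i - l] lies in [L], hence in the image of some translate [t_j + Z^d]. So
    [l] occurs at every base point [i]. *)
Lemma frame_vec l i : L l -> l != 0 ->
  exists j v, admissible i j v /\ l = A *m diff_vec X.2 i j v.
Proof.
move=> Ll l0; have : L (A *m transl X.2 i - l).
  apply: sL.2 => //.
  by have := frame_translate i 0; rewrite map_mx0 addr0.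
case: (fA) => uA _ _ {1}-> [x [j _ [z [v _ <-] <-]]] e.
exists j, v.
have lE : l = A *m diff_vec X.2 i j v.
  by rewrite /diff_vec -addrA -opprD mulmxBr e opprB addrC subrK.
split => // ij; apply/eqP => v0; move/eqP: l0; apply; rewrite lE ij v0.
by rewrite /diff_vec subrr map_mx0 subr0 mulmx0.
Qed.

Definition min_norm : R := inf [set qform 1%:M l | l in [set l | L l /\ l != 0]].

(** By [frame_diff] and [frame_vec] the vectors entering [lambda] are, up to [A], exactly the
    nonzero vectors of [L]; hence [lambda] is the same for all representations. *)
Lemma frame_lambda : lambda X = min_norm.
Proof.
congr inf; apply/seteqP; split => [r [i [j [v [adm ->]]]]|_ [l [Ll l0] <-]].
  exists (A *m diff_vec X.2 i j v); last by rewrite -frame_qform.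
  exact: frame_diff.
have [j [v [adm ->]]] := frame_vec 0 Ll l0.
by exists 0, j, v; split => //; rewrite -frame_qform.
Qed.

Lemma frame_coercive : exists2 c, 0 < c & forall x, c * `|x| ^+ 2 <= qform X.1 x.
Proof. by case: fA => uA <- _ _; apply: coercive_unit. Qed.

End Frame.

Definition minimal_vector (R : realType) (d : nat) (L : set 'cV[R]_d) l : Prop :=
  [/\ L l, l != 0 & qform 1%:M l = min_norm L].

(** A nonzero integer vector has max norm at least 1, so the coercivity constant of a basis is a
    lower bound. *)
Lemma min_norm_gt0 (R : realType) (d : nat) (A : 'M[R]_d) (L : set 'cV[R]_d) :
  (0 < d)%N -> subgroup L -> A \in unitmx -> L = mulmx A @` int_points R d ->
  0 < min_norm L.
Proof.
move=> d0 sL uA LE; have fA := basis_frame uA LE.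
rewrite -(frame_lambda sL fA).
have [c c0 hc] := frame_coercive fA.
apply: lt_le_trans (_ : c <= _) => //; apply: lambda_ge => // i j v adm.
apply: le_trans (hc _); rewrite ler_peMr //; first exact: ltW.
have v0 : v != 0 by apply: adm; rewrite (ord1 i) (ord1 j).
have {v0} [k vk] : exists k, v k ord0 != 0.
  apply: contrapT => h; move/eqP: v0; apply; apply/colP => k; rewrite mxE.
  by apply/eqP/negPn/negP => vk; apply: h; exists k.
rewrite exprn_ege1 // /diff_vec (ord1 i) (ord1 j) subrr sub0r normrN.
apply: le_trans (mx_entry_le _ k ord0); rewrite mxE -intr_norm.
rewrite (_ : 1 = (1%:Z)%:~R) // ler_int; lia.
Qed.

(** * Perturbations of the identity, and extreme lattices *)

Lemma near_pairP (R : realType) (m n p q : nat) (X : 'M[R]_(m, n) * 'M[R]_(p, q))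
    (P : 'M[R]_(m, n) * 'M[R]_(p, q) -> Prop) :
  (\forall Y \near X, P Y) <->
  exists2 r, 0 < r & forall Y, `|Y.1 - X.1| < r -> `|Y.2 - X.2| < r -> P Y.
Proof.
split=> [/nbhs_ballP[r /= r0 h]|[r r0 h]].
  by exists r => // Y Y1 Y2; apply: h; split; rewrite -ball_normE /ball_ /= distrC.
apply/nbhs_ballP; exists r => //= Y []; rewrite -!ball_normE /ball_ /= => Y1 Y2.
by apply: h; rewrite distrC.
Qed.

(** Serves to pick one [e] meeting several smallness conditions at once. *)
Lemma near0_mul_lt (R : realType) (a b : R) : 0 <= a -> 0 < b ->
  \forall e \near (0 : R)^'+, e * a < b.
Proof.
move=> a0 b0; have : 0 < b / (a + 1) by rewrite divr_gt0 // ltr_wpDl.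
move=> /nbhs_right_lt; apply: filter_app; near=> e.
rewrite ltr_pdivlMr ?ltr_wpDl // mulrDr mulr1 => h.
have : 0 < e by near: e; exact: nbhs_right_gt.
lra.
Unshelve. all: by end_near. Qed.

Lemma pos_def_near1 (R : realType) (d : nat) (K : 'M[R]_d) :
  K^T = K -> d%:R ^+ 2 * `|K| < 1 -> pos_def (1%:M + K).
Proof.
move=> Ks K1; split; first by rewrite linearD /= trmx1 Ks.
move=> x x0; rewrite qform_mxD.
have n0 : 0 < `|x| ^+ 2 by rewrite exprn_gt0 // normr_gt0.
have h : - qform K x <= d%:R ^+ 2 * `|K| * `|x| ^+ 2.
  apply: le_trans (ler_norm _) _; rewrite normrN; apply: le_trans (bform_le K x x) _.
  by rewrite le_eqVlt; apply/orP; left; apply/eqP; ring.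
have := norm_sqr_le_qform1 x.
have : d%:R ^+ 2 * `|K| * `|x| ^+ 2 < `|x| ^+ 2 by rewrite gtr_pMl.
lra.
Qed.

(** [pos_def_det] bounds determinants from above, so it is applied to the inverse [W] of [1 + K].
    Since [W = 1 - K + K K W] and [|W| <= 2], the quantity [tr W - d] is [- tr K] up to
    [2 d^3 |K|^2], hence negative, and [det W < 1]. *)
Lemma det_near1_gt1 (R : realType) (d : nat) (K : 'M[R]_d) (c : R) :
  K != 0 -> pos_def (1%:M + K) -> 2 * d%:R * `|K| <= 1 ->
  2 * d%:R ^+ 3 * `|K| < c -> c * `|K| <= \tr K -> 1 < \det (1%:M + K).
Proof.
move=> K0 Pp Kd Kc trK; have k0 : 0 < `|K| by rewrite normr_gt0.
have [dP _ _] := pos_def_det Pp.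
have uP : (1%:M + K) \in unitmx by rewrite unitmxE unitfE gt_eqF.
pose W := invmx (1%:M + K).
have WP : W + K *m W = 1%:M by rewrite -{1}[W]mul1mx -mulmxDl mulmxV.
have Ws : W^T = W by rewrite /W trmx_inv Pp.1.
have Wp : pos_def W.
  have := pos_def_congr (_ : W \in unitmx) Pp.
  by rewrite Ws mulVmx // mul1mx; apply; rewrite unitmx_inv.
have [dW hW _] := pos_def_det Wp.
have n1 : `|1%:M : 'M[R]_d| <= 1.
  by apply: mx_norm_le => // i j; rewrite mxE; case: eqP; rewrite ?normr1 ?normr0.
have e1 : W = 1%:M - K *m W by rewrite -WP addrK.
have W2 : `|W| <= 2.
  have : `|W| <= 1 + d%:R * (`|K| * `|W|).
    rewrite {1}e1; apply: le_trans (ler_normB _ _) _.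
    by apply: lerD => //; apply: mx_norm_mul.
  have : 2 * d%:R * `|K| * `|W| <= 1 * `|W| by apply: ler_wpM2r.
  by rewrite mul1r !mulrA; nra.
have tW : \tr W = d%:R - \tr K + \tr (K *m (K *m W)).
  have e2 : K *m W = K - K *m (K *m W) by rewrite {1}e1 mulmxBr mulmx1.
  by rewrite (congr1 mxtrace e1) linearB /= mxtrace1 (congr1 mxtrace e2) linearB /= opprB addrA addrAC.
have tKKW : \tr (K *m (K *m W)) <= 2 * d%:R ^+ 3 * `|K| * `|K|.
  apply: le_trans (ler_norm _) _; apply: le_trans (mx_trace_le _) _.
  apply: (@le_trans _ _ (d%:R * (d%:R * (`|K| * (d%:R * (`|K| * 2)))))).
    do 2!(apply: ler_wpM2l => //; try apply: le_trans (mx_norm_mul _ _) _).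
    by do 2!(apply: ler_wpM2l => //; try apply: le_trans (mx_norm_mul _ _) _);
       do ?apply: ler_wpM2l.
  by rewrite le_eqVlt; apply/orP; left; apply/eqP; ring.
have : \det W < 1.
  apply: le_lt_trans hW _; rewrite -[ltRHS]expR0 ltr_expR tW.
  have h : 2 * d%:R ^+ 3 * `|K| * `|K| < c * `|K| by rewrite ltr_pM2r.
  have := lt_le_trans (le_lt_trans tKKW h) trK; lra.
by rewrite /W det_inv invf_lt1.
Qed.

(** Suppose [tr K <= 0]. For small [e > 0] the forms [A^T (1 + e K) A] do not lower [lambda], by
    [lambda_ge_line], while [det (1 + e K) < exp (e tr K) <= 1], strictly because [K] is nonzero.
    The density would increase. *)
Lemma extreme_trace_gt0 (R : realType) (d : nat) (L : set 'cV[R]_d) (K : 'M[R]_d) :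
  (0 < d)%N -> subgroup L -> extreme L -> K^T = K -> K != 0 ->
  (forall l, minimal_vector L l -> 0 <= qform K l) -> 0 < \tr K.
Proof.
move=> d0 sL [A [uA LE /near_pairP[r r0 hr]]] Ks K0 Kmin.
have fA := basis_frame uA LE; set X := (_, _) in hr fA.
have l0 : 0 < lambda X by rewrite (frame_lambda sL fA); apply: min_norm_gt0 uA LE.
rewrite ltNge; apply/negP => trK.
pose H := A^T *m K *m A.
have QE e : X.1 + e *: H = A^T *m (1%:M + e *: K) *m A.
  by rewrite mulmxDr mulmxDl mulmx1 -scalemxAr -scalemxAl.
have [c c0 hc] := frame_coercive fA.
have [e0 e00 he] : exists2 e0, 0 < e0 & forall e, 0 <= e <= e0 ->
    lambda X <= lambda (X.1 + e *: H, X.2 + e *: (0 : 'M[R]_(d, 0))).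
  apply: (lambda_ge_line d0 c0 hc) => i j v adm eqm e ee.
  rewrite scaler0 addr0 QE qform_congr qform_mxD -(frame_qform fA) eqm.
  rewrite lerDl qform_mxZ mulr_ge0 //; apply: Kmin.
  have [Ll ln0] := frame_diff sL fA adm; split => //.
  by rewrite -(frame_qform fA) eqm (frame_lambda sL fA).
have [e [ep ee er ek]] : exists e, [/\ 0 < e, e <= e0, e * `|H| < r
    & e * (d%:R ^+ 2 * `|K|) < 1].
  apply: (@filter_ex _ (0^'+)); near=> e; split; near: e.
  - exact: nbhs_right_gt.
  - exact: nbhs_right_ltW.
  - exact: near0_mul_lt.
  - by apply: near0_mul_lt => //; rewrite mulr_ge0 // sqr_ge0.
have pP : pos_def (1%:M + e *: K).
  apply: pos_def_near1; first by rewrite linearZ /= Ks.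
  by rewrite normrZ gtr0_norm // mulrCA.
have pY := pos_def_congr uA pP.
have [dP _ hP] := pos_def_det pP.
have /hr : `|(X.1 + e *: H, X.2 + e *: (0 : 'M[R]_(d, 0))).1 - X.1| < r.
  by rewrite /= addrC addKr normrZ gtr0_norm.
rewrite scaler0 addr0 subrr normr0 => /(_ r0); rewrite QE => /(_ pY).
rewrite leNgt => /negP; apply; apply: delta_lt => //.
- by rewrite -QE; have := he e; rewrite scaler0 addr0; apply; rewrite (ltW ep).
- by have [] := pos_def_det pY.
have dE : \det X.1 = \det A * \det A by rewrite /X /= det_mulmx det_tr.
have {1}-> : \det (A^T *m (1%:M + e *: K) *m A, 0 : 'M[R]_(d, 0)).1
    = \det A * \det A * \det (1%:M + e *: K).
  by rewrite /= !det_mulmx det_tr; ring.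
have dA : 0 < \det A * \det A.
  by rewrite -expr2 exprn_even_gt0 //= -unitfE -unitmxE.
rewrite dE gtr_pMr //; apply: lt_le_trans (hP _) _.
  move=> /eqP; rewrite -subr_eq0 addrC addKr scaler_eq0 (gt_eqF ep) /=.
  exact/negP.
have : e * \tr K <= 0 by rewrite pmulr_rle0.
move=> eK; rewrite -[leRHS]expR0 ler_expR linearD /= mxtrace1 linearZ /=; lra.
Unshelve. all: by end_near. Qed.

Lemma minimal_vector_norm (R : realType) (d : nat) (L : set 'cV[R]_d) l :
  minimal_vector L l -> `|l| <= 1 + min_norm L.
Proof.
move=> [_ _ <-]; have := norm_sqr_le_qform1 l; have := normr_ge0 l; nra.
Qed.

(** By [extreme_trace_gt0] a nonzero symmetric [K] has positive trace or is negative at a minimal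
    vector; [linear_family_bound] makes the alternative quantitative. *)
Lemma extreme_gap (R : realType) (d : nat) (L : set 'cV[R]_d) :
  (0 < d)%N -> subgroup L -> extreme L ->
  exists2 c, 0 < c & forall K : 'M[R]_d, K^T = K -> K != 0 ->
    c * `|K| <= \tr K \/
    exists2 l, minimal_vector L l & qform K l <= - c * `|K|.
Proof.
move=> d0 sL eL.
(* The first summand detects the failure of symmetry of [K]. *)
pose I := ('I_d * 'I_d + option {l | minimal_vector L l})%type.
pose f (x : I) (K : 'M[R]_d) : R := match x with
  | inl (i, j) => K i j - K j i
  | inr None => - \tr K
  | inr (Some l) => qform K (sval l) end.
have [| | | |c c0 hc] := @linear_family_bound R d d I f.
- move=> [[i j]|[[l ml]|]] x y /=; first by rewrite !mxE; ring.
    by rewrite qform_mxD -scaleN1r qform_mxZ mulN1r.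
  by rewrite linearB opprB opprK addrC.
- move=> [[i j]|[[l ml]|]] a x /=; first by rewrite !mxE; ring.
    exact: qform_mxZ.
  by rewrite linearZ /= mulrN.
- move=> [[i j]|[[l ml]|]] /=.
  + exists 2 => K; apply: le_trans (ler_normB _ _) _.
    by have := mx_entry_le K i j; have := mx_entry_le K j i; lra.
  + exists (d%:R ^+ 2 * `|l| ^+ 2) => K; apply: le_trans (bform_le _ _ _) _.
    by rewrite le_eqVlt; apply/orP; left; apply/eqP; ring.
  + by exists d%:R => K; rewrite normrN mx_trace_le.
- move=> K K0; have [Ks|Kns] := eqVneq K^T K.
    apply: contrapT => h; apply: (h); exists (inr None); rewrite /= oppr_lt0.
    apply: (extreme_trace_gt0 d0 sL eL Ks K0) => l ml.
    by rewrite leNgt; apply/negP => Kl; apply: h; exists (inr (Some (exist _ l ml))).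
  have [i [j ij]] : exists i j, K i j != K j i.
    apply: contrapT => h; move/eqP: Kns; apply; apply/matrixP => i j; rewrite mxE.
    by apply/eqP/negPn/negP => ij; apply: h; exists j, i.
  case: (ltgtP (K i j) (K j i)) ij => // ij _.
    by exists (inl (i, j)); rewrite /= subr_lt0.
  by exists (inl (j, i)); rewrite /= subr_lt0.
exists c => // K Ks K0; have cK : 0 < c * `|K| by rewrite mulr_gt0 ?normr_gt0.
have [[[i j]|[[l ml]|]] /=] := hc K K0; rewrite mulNr.
- by rewrite -{2}Ks mxE subrr => h; exfalso; lra.
- by move=> h; right; exists l.
- by rewrite lerN2; left.
Qed.

(** * First-order effect of translations on minimal vectors *)

Section FrameGap.
Variables (R : realType) (d n : nat) (A : 'M[R]_d).
Variables (X : 'M[R]_d * 'M[R]_(d, n)) (L : set 'cV[R]_d).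
Hypotheses (d0 : (0 < d)%N) (sL : subgroup L) (fA : lattice_frame A X L).

Let minimal_triple (x : 'I_n.+1 * 'I_n.+1 * 'cV[int]_d) :=
  admissible x.1.1 x.1.2 x.2 /\
  minimal_vector L (A *m diff_vec X.2 x.1.1 x.1.2 x.2).

(** Half the derivative at 0 of the squared length of the difference vector when the translates move
    along [s]. *)
Let slope (x : 'I_n.+1 * 'I_n.+1 * 'cV[int]_d) (s : 'M[R]_(d, n)) : R :=
  bform 1%:M (A *m diff_vec X.2 x.1.1 x.1.2 x.2) (A *m rel_shift s x.1.1 x.1.2).

(** If all slopes were nonnegative, [|l + e u|^2 = |l|^2 + 2 e <l, u> + e^2 |u|^2] would prevent
    minimal vectors from shortening, and [lambda_ge_line] would turn [s] into a floating motion. *)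
Lemma nonfloating_slope s : ~ floating_form X -> s != 0 ->
  exists2 x, minimal_triple x & slope x s < 0.
Proof.
move=> nfl s0; apply: contrapT => h; apply: nfl.
have [c c0 hc] := frame_coercive fA.
have [|e e0 he] := @lambda_ge_line _ _ _ X c 0 s d0 c0 hc.
  move=> i j v adm eqm e e0.
  rewrite scaler0 addr0 diff_vecD rel_shiftZ (frame_qform fA) mulmxDr -scalemxAr.
  rewrite qform1D bformZr qformZ -(frame_qform fA) eqm -addrA lerDl.
  rewrite addr_ge0 ?mulr_ge0 ?sqr_ge0 ?qform1_ge0 //.
  rewrite leNgt; apply/negP => lt0; apply: h; exists (i, j, v) => //; split => //.
  have [Ll ln0] := frame_diff sL fA adm; split => //.
  by rewrite -(frame_qform fA) eqm (frame_lambda sL fA).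
by exists s, e; split => // u /he; rewrite scaler0 addr0.
Qed.

Lemma nonfloating_gap : ~ floating_form X ->
  exists2 c, 0 < c & forall s, s != 0 ->
    exists2 x, minimal_triple x & slope x s <= - c * `|s|.
Proof.
move=> nfl.
have [| | | |c c0 hc] := @linear_family_bound R d n {x | minimal_triple x}
    (fun x => slope (sval x)).
- by move=> [x mx] s s' /=;
  rewrite /slope rel_shiftB (mulmxBr A (rel_shift s _ _)) bformDr bformNr.
- by move=> [x mx] a s /=; rewrite /slope rel_shiftZ -scalemxAr bformZr.
- move=> [x mx] /=; rewrite /slope; set l := A *m _.
  exists (d%:R ^+ 2 * (`|1%:M : 'M[R]_d| * `|l|) * (d%:R * `|A| * 2)) => s.
  apply: le_trans (bform_le _ _ _) _; rewrite -!mulrA.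
  apply: ler_wpM2l => //.
  do 3!(apply: ler_wpM2l => //).
  apply: le_trans (mx_norm_mul _ _) _.
  by do 2!(apply: ler_wpM2l => //); apply: rel_shift_norm.
- move=> s s0; have [x mx xs] := nonfloating_slope nfl s0.
  by exists (exist _ x mx).
exists c => // s /hc[[x mx] hx]; by exists x.
Qed.

Lemma rel_shift_sum_perm (s : 'M[R]_(d, n)) (p : 'I_n.+1 -> 'I_n.+1) :
  injective p -> \sum_i rel_shift s i (p i) = 0.
Proof.
move=> ip; rewrite /rel_shift sumrB [X in X - _](reindex_inj ip) /=.
by rewrite subrr.
Qed.

(** Two base points sent to the same [j] differ by an integer vector, so they coincide by
    disjointness of the translates. *)
Lemma frame_perm l : L l -> l != 0 ->
  exists p : 'I_n.+1 -> 'I_n.+1, exists v : 'I_n.+1 -> 'cV[int]_d,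
    injective p /\ forall i, admissible i (p i) (v i) /\
                             l = A *m diff_vec X.2 i (p i) (v i).
Proof.
move=> Ll l0.
have h i : exists jv : 'I_n.+1 * 'cV[int]_d,
    admissible i jv.1 jv.2 /\ l = A *m diff_vec X.2 i jv.1 jv.2.
  by have [j [v jv]] := frame_vec sL fA i Ll l0; exists (j, v).
have [f hf] := choice h.
exists (fun i => (f i).1), (fun i => (f i).2); split => // i i' ii'.
have [uA _ _ _] := fA.
have : diff_vec X.2 i (f i).1 (f i).2 = diff_vec X.2 i' (f i').1 (f i').2.
  rewrite -(mulKmx uA (diff_vec X.2 i _ _)) -(hf i).2.
  by rewrite {1}(hf i').2 mulKmx.
rewrite /diff_vec ii' => e; apply: (transl_inj fA (v := (f i).2 - (f i').2)).
rewrite map_mxB; apply/eqP; rewrite -subr_eq0.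
move/eqP: e; rewrite -subr_eq0 => /eqP e; apply/eqP; rewrite -[RHS]e.
by apply/colP => k; rewrite !mxE; ring.
Qed.

End FrameGap.

(** * Extreme and non-floating forms are isolated *)

Section Isolated.
Variables (R : realType) (d n : nat) (A : 'M[R]_d).
Variables (X : 'M[R]_d * 'M[R]_(d, n)) (L : set 'cV[R]_d).
Hypotheses (d0 : (0 < d)%N) (sL : subgroup L) (fA : lattice_frame A X L).

(** This is [|l|^2 = lambda X = lambda Y <= (1 + K)[l + u]], expanded, with [|l|^2] cancelled. *)
Lemma minimal_constraint (K : 'M[R]_d) (s : 'M[R]_(d, n)) i j v :
  let Y := (A^T *m (1%:M + K) *m A, X.2 + s) in
  let l := A *m diff_vec X.2 i j v in let u := A *m rel_shift s i j in
  pos_def (1%:M + K) -> lambda Y = lambda X -> admissible i j v ->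
  minimal_vector L l ->
  0 <= qform K l + 2 * bform 1%:M l u + 2 * bform K l u
       + (qform 1%:M u + qform K u).
Proof.
move=> Y l u pK lY adm [_ _ lE].
have Ks : K^T = K.
  by have := pK.1; rewrite linearD /= trmx1 => /addrI.
have uA : A \in unitmx by case: fA.
have := @lambda_le _ _ _ Y i j v (fun x => pos_def_ge0 x (pos_def_congr uA pK)) adm.
rewrite lY (frame_lambda sL fA) -lE /= diff_vecD qform_congr (mulmxDr A (diff_vec _ _ _ _)).
rewrite -/l -/u qform_mxD qform1D (qformD l u Ks); lra.
Qed.

(** Minimal vectors are bounded by [rho] and [|u|] by [D |s|], so one constant serves all of them;
    it sums the four individual constants, plus 1 for positivity. *)
Lemma minimal_shift_bound : exists2 M, 0 < M &
  forall (K : 'M[R]_d) (s : 'M[R]_(d, n)) (l : 'cV[R]_d) i j,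
  minimal_vector L l -> let u := A *m rel_shift s i j in
  [/\ qform K l <= M * `|K|, 2 * bform K l u <= M * (`|K| * `|s|),
      qform 1%:M u <= M * `|s| ^+ 2 & qform K u <= M * (`|K| * `|s| ^+ 2)].
Proof.
pose rho := 1 + `|min_norm L|; pose D := d%:R * (`|A| * 2).
have D0 : 0 <= D by rewrite !mulr_ge0.
have rho0 : 0 <= rho by rewrite addr_ge0.
pose d2 : R := d%:R ^+ 2.
have d20 : 0 <= d2 by exact: sqr_ge0.
pose M1 := d2 * rho ^+ 2; pose M2 := 2 * (d2 * rho * D).
pose M3 := d%:R * D ^+ 2; pose M4 := d2 * D ^+ 2.
have M10 : 0 <= M1 by rewrite mulr_ge0 // sqr_ge0.
have M20 : 0 <= M2 by rewrite !mulr_ge0.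
have M30 : 0 <= M3 by rewrite mulr_ge0 // sqr_ge0.
have M40 : 0 <= M4 by rewrite mulr_ge0 // sqr_ge0.
exists (M1 + M2 + M3 + M4 + 1); first by rewrite ltr_wpDl // !addr_ge0.
move=> K s l i j ml u.
have lr : `|l| <= rho.
  apply: le_trans (minimal_vector_norm ml) _.
  by rewrite lerD2l ler_norm.
have uD : `|u| <= D * `|s|.
  apply: le_trans (mx_norm_mul _ _) _; rewrite /D -!mulrA.
  by do 2!(apply: ler_wpM2l => //); apply: rel_shift_norm.
have leM (c m b : R) : 0 <= b -> c <= m * b -> m <= M1 + M2 + M3 + M4 + 1 ->
    c <= (M1 + M2 + M3 + M4 + 1) * b.
  by move=> b0 cm mM; apply: le_trans cm _; apply: ler_wpM2r.
have bound x y (p q : R) : `|x| <= p -> `|y| <= q -> bform K x y <= d2 * (`|K| * p * q).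
  move=> xp yq; apply: le_trans (ler_norm _) _; apply: le_trans (bform_le _ _ _) _.
  apply: ler_wpM2l => //; apply: ler_pM => //.
  exact: ler_wpM2l.
split.
- apply: (leM _ M1) => //; last by lra.
  apply: le_trans (bound _ _ _ _ lr lr) _.
  by rewrite le_eqVlt; apply/orP; left; apply/eqP; rewrite /M1; ring.
- apply: (leM _ M2); [exact: mulr_ge0 | | by lra].
  have := bound _ _ _ _ lr uD; rewrite /M2; nra.
- apply: (leM _ M3); [exact: sqr_ge0 | | by lra].
  apply: le_trans (qform1_le_norm_sqr _) _; rewrite /M3 -mulrA; apply: ler_wpM2l => //.
  by rewrite -exprMn ler_pXn2r ?nnegrE // mulr_ge0.
- apply: (leM _ M4); [by rewrite mulr_ge0 // sqr_ge0 | | by lra].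
  apply: le_trans (bound _ _ _ _ uD uD) _.
  by rewrite le_eqVlt; apply/orP; left; apply/eqP; rewrite /M4; ring.
Qed.

(* The translational part is controlled by the metrical part by [nonfloating_gap];
   summing the constraints of a minimal vector over its [m] base points cancels
   the terms linear in the translations, so that it can only shrink to second
   order, and the trace must then grow to first order. *)
Lemma nonfloating_isolated : extreme L -> ~ floating_form X -> isolated_extreme X.
Proof.
move=> eL nfl.
have [M M0 hM] := minimal_shift_bound.
have [c1 c10 h1] := nonfloating_gap d0 sL fA nfl.
have [c2 c20 h2] := extreme_gap d0 sL eL.
have [uA AX _ _] := fA.
pose B := invmx A.
pose G := M / c1.
have G0 : 0 < G by rewrite divr_gt0.
have M3 : 0 <= 3 * M by rewrite mulr_ge0 // ltW.
have M2 : 0 <= 2 * M by rewrite mulr_ge0 // ltW.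
have MG : 0 <= 2 * M * G ^+ 2 by rewrite mulr_ge0 ?sqr_ge0.
have dd : 0 <= 2 * d%:R + 1 :> R by rewrite addr_ge0 // mulr_ge0.
have ddd : 0 <= 2 * d%:R ^+ 3 :> R by rewrite mulr_ge0 // exprn_ge0.
(* [eta] will bound both [|K|] and [|s|]. Its conditions absorb, in order, the higher-order terms in
   the proof of [|s| <= G |K|], the second-order loss in [K[l]], and the error terms of
   [det_near1_gt1]. *)
have [eta [e0 eM eG ed1 ec]] : exists e : R, [/\ 0 < e, e * (3 * M) < c1,
    e * (2 * M * G ^+ 2) < c2, e * (2 * d%:R + 1) < 1 & e * (2 * d%:R ^+ 3) < c2].
  apply: (@filter_ex _ (0^'+)); near=> e; split; near: e.
  - exact: nbhs_right_gt.
  - exact: near0_mul_lt.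
  - exact: near0_mul_lt.
  - exact: near0_mul_lt.
  - exact: near0_mul_lt.
have ed0 : 0 <= eta * (2 * d%:R) by rewrite !mulr_ge0 // ltW.
have e1 : eta < 1 by move: ed1; rewrite mulrDr mulr1; lra.
have ed : eta * (2 * d%:R) < 1 by move: ed1; rewrite mulrDr mulr1; lra.
(* For [K = B^T (Y.1 - X.1) B] this gives [|K| <= |Y.1 - X.1| a]. *)
pose a := d%:R * (d%:R * (`|B^T| * `|B|)).
have a0 : 0 <= a by rewrite !mulr_ge0.
have [r [r0 reta ra]] : exists r : R, [/\ 0 < r, r * 1 < eta & r * a < eta].
  apply: (@filter_ex _ (0^'+)); near=> r; split; near: r.
  - exact: nbhs_right_gt.
  - exact: near0_mul_lt.
  - exact: near0_mul_lt.
apply/near_pairP; exists r => // Y YQ Yt pY YX lY.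
pose K := B^T *m (Y.1 - X.1) *m B; pose s := Y.2 - X.2.
have Y1 : Y.1 = A^T *m (1%:M + K) *m A.
  rewrite mulmxDr mulmxDl mulmx1 AX /K !mulmxA -trmx_mul mulVmx // trmx1 mul1mx.
  by rewrite -mulmxA mulVmx // mulmx1 addrC subrK.
have Y2 : Y.2 = X.2 + s by rewrite /s addrC subrK.
have YE : Y = (A^T *m (1%:M + K) *m A, X.2 + s) by rewrite -Y1 -Y2; case: (Y).
have pK : pos_def (1%:M + K).
  have := pos_def_congr (_ : B \in unitmx) pY; rewrite unitmx_inv => /(_ uA).
  rewrite Y1 !mulmxA -trmx_mul mulmxV // trmx1 mul1mx.
  by rewrite -mulmxA mulmxV // mulmx1.
have Ks : K^T = K.
  by have := pK.1; rewrite linearD /= trmx1 => /addrI.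
have Keta : `|K| < eta.
  apply: le_lt_trans ra; rewrite /K.
  apply: (@le_trans _ _ (d%:R * ((d%:R * (`|B^T| * `|Y.1 - X.1|)) * `|B|))).
    apply: le_trans (mx_norm_mul _ _) _; apply: ler_wpM2l => //.
    by apply: ler_wpM2r => //; apply: mx_norm_mul.
  rewrite (_ : _ * _ = `|Y.1 - X.1| * a); last by rewrite /a; ring.
  by apply: ler_wpM2r => //; apply: ltW.
have seta : `|s| < eta by apply: lt_trans Yt _; rewrite mulr1 in reta.
have cstr i j v := @minimal_constraint K s i j v pK (etrans (congr1 _ (esym YE)) lY).
have k0 : 0 <= `|K| by [].
have s0 : 0 <= `|s| by [].
(* At a triple of slope at most [- c1 |s|] the constraint gives
   [0 <= M |K| - 2 c1 |s| + 3 M eta |s|], and [3 M eta < c1]. *)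
have sGK : `|s| <= G * `|K|.
  have [->|sn0] := eqVneq s 0; first by rewrite normr0 mulr_ge0 // ltW.
  have [[[i j] v] /= [adm ml] sl] := h1 s sn0.
  have := cstr i j v adm ml => /= cs.
  have [b1 b2 b3 b4] := hM K s _ i j ml.
  have ks : `|K| * `|s| <= eta * `|s| by apply: ler_wpM2r => //; apply: ltW.
  have ss : `|s| ^+ 2 <= eta * `|s| by rewrite expr2; apply: ler_wpM2r => //;
    apply: ltW.
  have kss : `|K| * `|s| ^+ 2 <= eta * `|s|.
    apply: le_trans ss; rewrite ler_piMl ?sqr_ge0 //.
    by apply: ltW; apply: lt_trans Keta _; lra.
  have mk := ler_wpM2l (ltW M0) ks.
  have ms := ler_wpM2l (ltW M0) ss.
  have mks := ler_wpM2l (ltW M0) kss.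
  have es : eta * (3 * M) * `|s| <= c1 * `|s| by apply: ler_wpM2r => //; apply: ltW.
  rewrite /G mulrAC ler_pdivlMr //; lra.
have [K0|Kn0] := eqVneq K 0.
  case: YX; rewrite YE K0 addr0 mulmx1 AX.
  have -> : s = 0.
    by apply/eqP; rewrite -normr_le0; move: sGK; rewrite K0 normr0 mulr0.
  by rewrite addr0; case: (X).
have kp : 0 < `|K| by rewrite normr_gt0.
(* A minimal [l] with [K[l] <= - c2 |K|] is impossible: the summed constraints give [K[l] >= - 2 M
   |s|^2 >= - 2 M G^2 |K|^2], while [2 M G^2 |K| < c2]. *)
have {h2} [trK|[l ml Kl]] := h2 K Ks Kn0; last first.
  exfalso; have [Ll l0 _] := ml.
  have [p [v [ip pv]]] := frame_perm sL fA Ll l0.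
  pose u i := A *m rel_shift s i (p i).
  have u0 : \sum_i u i = 0.
    by rewrite /u -mulmx_sumr rel_shift_sum_perm // mulmx0.
  have c i : 0 <= qform K l + 2 * bform 1%:M l (u i) + 2 * bform K l (u i)
                  + 2 * M * `|s| ^+ 2.
    have [adm lE] := pv i.
    have := cstr i (p i) (v i) adm; rewrite -lE => /(_ ml) cs.
    have [_ _ b3 b4] := hM K s _ i (p i) ml.
    have : `|K| * `|s| ^+ 2 <= `|s| ^+ 2.
      by rewrite ler_piMl ?sqr_ge0 //; apply: ltW; apply: lt_trans Keta _; lra.
    move=> /(ler_wpM2l (ltW M0)); move: cs b3 b4; rewrite /= -/(u i); lra.
  have : 0 <= \sum_i (qform K l + 2 * bform 1%:M l (u i) + 2 * bform K l (u i)
                  + 2 * M * `|s| ^+ 2) by apply: sumr_ge0.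
  have lin Q : \sum_i 2 * bform Q l (u i) = 0.
    by rewrite -mulr_sumr -bform_sumr u0 bform0r mulr0.
  rewrite !big_split /= !lin !addr0.
  rewrite !sumr_const card_ord -mulrnDl pmulrn_lge0 // => h.
  have s2 : `|s| ^+ 2 <= G ^+ 2 * `|K| ^+ 2.
    by rewrite -exprMn ler_pXn2r ?nnegrE // mulr_ge0 // ltW.
  have : c2 * `|K| <= `|K| * (2 * M * G ^+ 2) * `|K|.
    have := ler_wpM2l (ltW M0) s2; move: h Kl; rewrite (expr2 `|K|); lra.
  rewrite ler_pM2r // leNgt => /negP; apply; apply: le_lt_trans eG.
  by apply: ler_wpM2r; [|exact: ltW].
have det1 : 1 < \det (1%:M + K).
  apply: (det_near1_gt1 Kn0 pK _ _ trK).
    by apply: le_trans (ltW ed); rewrite mulrC; apply: ler_wpM2r;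
      [rewrite mulr_ge0 | exact: ltW].
  by apply: le_lt_trans ec; rewrite mulrC; apply: ler_wpM2r;
    [rewrite mulr_ge0 // exprn_ge0 | exact: ltW].
have lX : 0 < lambda X.
  rewrite (frame_lambda sL fA); have [A0 [uA0 LE _]] := eL.
  exact: min_norm_gt0 uA0 LE.
have [dX _ _] := pos_def_det (frame_pos_def fA).
apply: delta_lt; rewrite ?lY //.
have -> : \det Y.1 = \det X.1 * \det (1%:M + K).
  by rewrite Y1 -AX !det_mulmx det_tr; ring.
by rewrite ltr_pMr.
Unshelve. all: by end_near. Qed.

End Isolated.

(** * Existence of a lattice basis *)

Lemma subgroup_mulrz (R : realType) (d : nat) (L : set 'cV[R]_d) x (z : int) :
  subgroup L -> L x -> L (z%:~R *: x).
Proof.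
move=> sL Lx; have nat_mul k : L (k%:R *: x).
  elim: k => [|k IH]; first by rewrite scale0r; apply: sL.1.
  by rewrite -natr1 scalerDl scale1r; apply: subgroupD.
case: z => k; first exact: nat_mul.
rewrite NegzE mulrNz scaleNr -[- _]add0r; apply: sL.2; last exact: nat_mul.
exact: sL.1.
Qed.

Lemma subgroup_int_comb (R : realType) (d : nat) (L : set 'cV[R]_d) (B : 'M[R]_d)
    (v : 'cV[int]_d) :
  subgroup L -> (forall j, L (col j B)) -> L (B *m map_mx intr v).
Proof.
move=> sL LB; have -> : B *m map_mx intr v = \sum_j (v j 0)%:~R *: col j B.
  apply/colP => i; rewrite !mxE summxE; apply: eq_bigr => j _.
  by rewrite !mxE mulrC.
elim/big_ind: _ => [|x y Lx Ly|i _]; first exact: sL.1.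
  exact: subgroupD.
exact: subgroup_mulrz.
Qed.

Lemma floor_bounds (R : realType) (x : R) :
  (Num.floor x)%:~R <= x < (Num.floor x)%:~R + 1.
Proof. by have := floor_itv x; rewrite intrD. Qed.

(* Pigeonhole: among sufficiently many multiples of [l], reduced modulo the
   columns of [B], two lie so close that discreteness identifies them. *)
Lemma discrete_torsion (R : realType) (d : nat) (L : set 'cV[R]_d) (B : 'M[R]_d) r :
  subgroup L -> 0 < r -> (forall l, L l -> `|l| < r -> l = 0) ->
  B \in unitmx -> (forall j, L (col j B)) ->
  exists2 N : nat, (0 < N)%N &
    forall l, L l -> exists v : 'cV[int]_d, N%:R *: l = B *m map_mx intr v.
Proof.
move=> sL r0 hr uB LB.
(* With [q < K + 1], coordinates of size at most [1 / (K + 1)] with respect to [B] give a point of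
   norm below [r]. *)
pose q := d%:R * `|B| / r.
have q0 : 0 <= q by rewrite divr_ge0 ?mulr_ge0 // ltW.
pose K := Num.bound q.
have Kq : q < K.+1%:R by apply: lt_trans (archi_boundP q0) _; rewrite ltr_nat.
have K0 : 0 < K.+1%:R :> R by rewrite ltr0n.
pose T := {ffun 'I_d -> 'I_K.+1}.
(* The pigeonhole yields a multiple [m l] with [1 <= m <= #|T|] depending on [l]; the factorial is
   divisible by all such [m]. *)
exists ((#|T|)`!); first exact: fact_gt0.
move=> l Ll; have [y lE] : exists y, l = B *m y by exists (invmx B *m l);
  rewrite mulKVmx.
pose fr (x : R) := x - (Num.floor x)%:~R.
have fr01 x : 0 <= fr x < 1 by have := floor_bounds x; rewrite /fr; lra.
pose cell (k : 'I_#|T|.+1) : T :=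
  [ffun i => inord (absz (Num.floor (K.+1%:R * fr (k%:R * y i 0))))].
have cellE k i : (cell k i : nat)%:Z = Num.floor (K.+1%:R * fr (k%:R * y i 0)).
  rewrite ffunE; set a := _ * fr _.
  have a0 : 0 <= a by rewrite mulr_ge0 //; case/andP: (fr01 (k%:R * y i 0)).
  have aK : a < K.+1%:R.
    by rewrite /a gtr_pMr //; case/andP: (fr01 (k%:R * y i 0)).
  have f0 : 0 <= Num.floor a by rewrite floor_ge0.
  have fK : Num.floor a < K.+1%:Z.
    by rewrite floor_lt_int.
  rewrite inordK; lia.
have /injectivePn[k1 [k2 k12 ck]] : ~~ injectiveb cell.
  by apply/negP => /injectiveP/leq_card; rewrite card_ord ltnn.
have {k12 ck} [a [b [ab cab]]] : exists a b : 'I_#|T|.+1, (a < b)%N /\ cell a = cell b.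
  move: k12; rewrite -val_eqE neq_ltn => /orP[h|h]; first by exists k1, k2.
  by exists k2, k1.
pose w : 'cV[int]_d := \col_i (Num.floor (b%:R * y i 0) - Num.floor (a%:R * y i 0)).
pose m := (b - a)%N.
have mR : m%:R = b%:R - a%:R :> R by rewrite natrB // ltnW.
have small : `|m%:R *: y - map_mx intr w| <= K.+1%:R^-1.
  apply: mx_norm_le => [|i j]; first by rewrite invr_ge0 ltW.
  rewrite (ord1 j) !mxE mR intrB.
  rewrite (_ : `|_| = `|fr (b%:R * y i 0) - fr (a%:R * y i 0)|); last first.
    by congr `|_|; rewrite /fr; ring.
  rewrite -[leRHS]mul1r ler_pdivlMr // -(gtr0_norm K0) -normrM mulrC mulrBr.
  have := floor_bounds (K.+1%:R * fr (b%:R * y i 0)).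
  have := floor_bounds (K.+1%:R * fr (a%:R * y i 0)).
  by rewrite -!cellE cab ler_norml; lra.
have mlE : m%:R *: l = B *m map_mx intr w.
  apply/eqP; rewrite -subr_eq0; apply/eqP/hr.
    apply: sL.2; last exact: subgroup_int_comb.
    by rewrite -[m%:R]/((m%:Z)%:~R); apply: subgroup_mulrz.
  rewrite lE scalemxAr -mulmxBr; apply: le_lt_trans (mx_norm_mul _ _) _.
  apply: (@le_lt_trans _ _ (d%:R * (`|B| * K.+1%:R^-1))).
    by rewrite ler_wpM2l // ler_wpM2l.
  by rewrite mulrA ltr_pdivrMr // [ltRHS]mulrC -ltr_pdivrMr.
have /dvdnP[c cE] : (m %| (#|T|)`!)%N.
  apply: dvdn_fact; rewrite subn_gt0 ab /=.
  by apply: leq_trans (leq_subr _ _) _; rewrite -ltnS ltn_ord.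
exists (c%:Z *: w); rewrite cE natrM -scalerA mlE map_mxZ /=.
by rewrite -scalemxAr.
Qed.

(* Among the bases of the ambient space contained in [L], the determinants are
   multiples of a fixed positive real; one of least absolute value is a basis of [L],
   as otherwise reducing a vector modulo it would produce a smaller one. *)
Lemma lattice_basis (R : realType) (d : nat) (L : set 'cV[R]_d) : is_lattice L ->
  exists2 A : 'M[R]_d, A \in unitmx & L = mulmx A @` int_points R d.
Proof.
move=> [[L0 LB] iso [B [rB LcolB]]].
have sL : subgroup L by [].
have uB : B \in unitmx by rewrite -row_full_unit /row_full rB.
have [r r0 hr] : exists2 r, 0 < r & forall l, L l -> `|l| < r -> l = 0.
  have [_ [V /nbhs_ballP[r /= r0 rV] VL]] := iso 0 L0.
  exists r => // l Ll lr; have : (V `&` L) l.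
    by split => //; apply: rV; rewrite -ball_normE /ball_ /= sub0r normrN.
  by rewrite VL.
have [N N0 hN] := discrete_torsion sL r0 hr uB LcolB.
have NR : 0 < N%:R :> R by rewrite ltr0n.
have dB : 0 < `|\det B| by rewrite normr_gt0 -unitfE -unitmxE.
(* Here [N C = B V] with [V] integral; take determinants. *)
have detL (C : 'M[R]_d) : (forall j, L (col j C)) ->
    exists k : nat, N%:R ^+ d * `|\det C| = `|\det B| * k%:R.
  move=> LC; have [v hv] := choice (fun j => hN _ (LC j)).
  pose V : 'M[int]_d := \matrix_(i, j) v j i 0.
  have e : N%:R *: C = B *m map_mx intr V.
    apply/matrixP => i j; move/colP: (hv j) => /(_ i); rewrite !mxE => ->.
    by apply: eq_bigr => k _; rewrite !mxE.
  exists (absz (\det V)); have := congr1 (fun M => `|\det M|) e.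
  rewrite detZ det_mulmx det_map_mx !normrM normrX (gtr0_norm NR) => ->.
  by rewrite -intr_norm -natr_absz.
pose P (k : nat) := `[< exists C : 'M[R]_d, [/\ forall j, L (col j C), \det C != 0 &
    N%:R ^+ d * `|\det C| = `|\det B| * k%:R] >].
have exP : exists k, P k.
  have [k hk] := detL B LcolB; exists k; apply/asboolP; exists B; split => //.
  by rewrite -normr_gt0.
case: (ex_minnP exP) => k /asboolP[C [LC dC hC]] kmin.
have uC : C \in unitmx by rewrite unitmxE unitfE.
exists C => //; apply/seteqP; split => [l Ll|_ [_ [v _ <-] <-]]; last first.
  exact: subgroup_int_comb.
have [x lE] : exists x, l = C *m x by exists (invmx C *m l); rewrite mulKVmx.
have [h|[i xi]] : (forall i, x i 0 = (Num.floor (x i 0))%:~R) \/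
    exists i, x i 0 != (Num.floor (x i 0))%:~R.
  have [|/existsNP[i /eqP]] := pselect (forall i, x i 0 = (Num.floor (x i 0))%:~R).
    by left.
  by right; exists i.
  exists x => //; exists (\col_i Num.floor (x i 0)) => //.
  by apply/colP => i; rewrite !mxE -h.
exfalso; pose f := x i 0 - (Num.floor (x i 0))%:~R.
have f0 : 0 < f.
  have /andP[h _] := floor_bounds (x i 0).
  by rewrite /f subr_gt0 lt_neqAle eq_sym xi.
have f1 : f < 1 by have := floor_bounds (x i 0); rewrite /f; lra.
pose x' : 'cV[R]_d := x - (Num.floor (x i 0))%:~R *: delta_mx i 0.
(* [C *m E] replaces column [i] of [C] by [l] minus an integer multiple of that column; this
   multiplies the determinant by the fractional part [f], strictly between 0 and 1. *)
pose E : 'M[R]_d := \matrix_(a, b) if b == i then x' a 0 else (a == b)%:R.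
have x'i : x' i 0 = f by rewrite !mxE !eqxx mulr1.
have detE : \det E = f.
  rewrite (expand_det_row E i) (bigD1 i) //= big1 ?addr0 => [|j ji]; last first.
    by rewrite mxE (negPf ji) eq_sym (negPf ji) mul0r.
  rewrite mxE eqxx x'i /cofactor -signr_odd addnn odd_double expr0 mul1r.
  rewrite (_ : row' i (col' i E) = 1%:M) ?det1 ?mulr1 //.
  apply/matrixP => a b; rewrite !mxE eq_sym (negPf (neq_lift i b)).
  by rewrite (inj_eq lift_inj).
have LCE j : L (col j (C *m E)).
  have -> : col j (C *m E) = C *m col j E.
    by apply/colP => a; rewrite !mxE; apply: eq_bigr => b _; rewrite !mxE.
  have [->|ji] := eqVneq j i.
    have -> : col i E = x' by apply/colP => a; rewrite !mxE eqxx.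
    rewrite mulmxBr -lE -scalemxAr -colE; apply: sL.2 => //.
    exact: subgroup_mulrz.
  have -> : col j E = delta_mx j 0.
    by apply/colP => a; rewrite !mxE (negPf ji) eqxx andbT.
  by rewrite -colE.
have [k' hk'] := detL _ LCE.
have dCE : \det (C *m E) = \det C * f by rewrite det_mulmx detE.
have : (k <= k')%N.
  apply: kmin; apply/asboolP; exists (C *m E); split => //.
  by rewrite dCE mulf_neq0 // gt_eqF.
rewrite leqNgt => /negP; apply.
rewrite -(ltr_nat R) -(ltr_pM2l dB) -hk' -hC dCE normrM (gtr0_norm f0).
by rewrite mulrA gtr_pMr // mulr_gt0 ?exprn_gt0 ?normr_gt0.
Qed.

(** * Rescaling of forms, and the consequences of strict periodic extremality *)

Lemma pos_defZ (R : realType) (d : nat) a (Q : 'M[R]_d) :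
  0 < a -> pos_def Q -> pos_def (a *: Q).
Proof.
move=> a0 [Qs Qp]; split; first by rewrite linearZ /= Qs.
by move=> x x0; rewrite qform_mxZ mulr_gt0 // Qp.
Qed.

Section Scaling.
Variables (R : realType) (d n : nat).
Implicit Types X Y : 'M[R]_d * 'M[R]_(d, n).
Hypothesis d0 : (0 < d)%N.

Lemma lambda_scale a X : 0 < a -> pos_def X.1 ->
  lambda (a *: X.1, X.2) = a * lambda X.
Proof.
move=> a0 pX; apply/eqP; rewrite eq_le; apply/andP; split.
  rewrite -ler_pdivrMl //; apply: lambda_ge => // i j v adm.
  rewrite ler_pdivrMl // -qform_mxZ.
  by apply: (@lambda_le _ _ _ (a *: X.1, X.2)) => // x; apply/pos_def_ge0/pos_defZ.
apply: lambda_ge => // i j v adm; rewrite qform_mxZ ler_pM2l //.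
by apply: lambda_le => // x; apply: pos_def_ge0.
Qed.

(** Both [lambda] and the [d]-th root of the determinant are homogeneous of degree 1. *)
Lemma delta_scale a X : 0 < a -> pos_def X.1 -> delta (a *: X.1, X.2) = delta X.
Proof.
move=> a0 pX; have [dX _ _] := pos_def_det pX.
have lE := lambda_scale a0 pX.
have dE : \det (a *: X.1) `^ d%:R^-1 = a * \det X.1 `^ d%:R^-1.
  rewrite detZ powRM; [|exact/exprn_ge0/ltW|exact: ltW].
  rewrite -powR_mulrn; last exact: ltW.
  rewrite -powRrM divff; last by rewrite pnatr_eq0 -lt0n.
  by rewrite powRr1 // ltW.
rewrite /delta lE [(_, _).1]/= dE.
rewrite -mulf_div divff; last by rewrite gt_eqF.
by rewrite mul1r.
Qed.

Lemma lambda_perturb X Y th : Y.2 = X.2 -> pos_def X.1 -> pos_def Y.1 -> 0 <= th < 1 ->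
  (forall x, `|qform (Y.1 - X.1) x| <= th * qform X.1 x) ->
  (1 - th) * lambda X <= lambda Y <= (1 + th) * lambda X.
Proof.
move=> YX pX pY /andP[t0 t1] h.
have hx x : (1 - th) * qform X.1 x <= qform Y.1 x <= (1 + th) * qform X.1 x.
  have := h x; rewrite ler_norml.
  have -> : qform Y.1 x = qform X.1 x + qform (Y.1 - X.1) x.
    by rewrite -qform_mxD addrC subrK.
  by rewrite mulrBl mulrDl mul1r; lra.
apply/andP; split.
  apply: lambda_ge => // i j v adm; have /andP[+ _] := hx (diff_vec Y.2 i j v).
  apply: le_trans; rewrite YX; apply: ler_wpM2l; first by rewrite subr_ge0 ltW.
  by apply: lambda_le => // x; apply: pos_def_ge0.
have t1' : 0 < 1 + th by rewrite ltr_pwDl.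
rewrite -ler_pdivrMl //; apply: lambda_ge => // i j v adm.
rewrite ler_pdivrMl //; have /andP[_] := hx (diff_vec X.2 i j v).
by apply: le_trans; rewrite -YX; apply: lambda_le => // x; apply: pos_def_ge0.
Qed.

End Scaling.

Lemma basis_represents (R : realType) (d : nat) (A : 'M[R]_d) (L : set 'cV[R]_d) :
  A \in unitmx -> L = mulmx A @` int_points R d ->
  represents (A^T *m A, 0 : 'M[R]_(d, 0)) L.
Proof.
move=> uA LE; have fA := basis_frame uA LE.
split; [exact: (frame_pos_def fA) | by case: fA | exists A, id; split => //].
by case: fA => _ _ _ ->; rewrite image_id.
Qed.

(** Isolated extremality only compares forms of equal [lambda]. A nearby [Y] is therefore rescaled
    by [a = lambda X / lambda Y], which preserves [delta]; [a] is near 1 by [lambda_perturb], so the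
    rescaled form is still near [X]. *)
Lemma strict_extreme (R : realType) (d : nat) (L : set 'cV[R]_d) :
  (0 < d)%N -> is_lattice L -> strict_periodic_extreme L -> extreme L.
Proof.
move=> d0 latL spe; have [A uA LE] := lattice_basis latL.
have sL : subgroup L by case: latL.
have fA := basis_frame uA LE; have rX := basis_represents uA LE.
exists A; split => //; have /near_pairP[r r0 hr] := spe _ _ rX.
set X := (_, _) in fA rX hr *.
have lX : 0 < lambda X by rewrite (frame_lambda sL fA); apply: min_norm_gt0 uA LE.
have pX := frame_pos_def fA.
have [c c0 hc] := frame_coercive fA.
(* By coercivity [|H[x]| <= |H| q X.1[x]]. The constant [g] is such that the rescaled form lies
   within [e g] of [X]. *)
pose q := d%:R ^+ 2 / c; have q0 : 0 <= q by rewrite divr_ge0 ?sqr_ge0 // ltW.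
pose g := 4 * q * (`|X.1| + 1) + 1.
have X10 : 0 <= `|X.1| + 1 by rewrite addr_ge0.
have g0 : 0 <= g by apply: addr_ge0 => //; apply: mulr_ge0 => //; apply: mulr_ge0.
have [e [e0 eq_lt eg e1]] : exists e : R, [/\ 0 < e, e * q < 2^-1, e * g < r & e * 1 < 1].
  apply: (@filter_ex _ (0^'+)); near=> e; split; near: e.
  - exact: nbhs_right_gt.
  - by apply: near0_mul_lt; rewrite ?invr_gt0.
  - exact: near0_mul_lt.
  - exact: near0_mul_lt ler01 ltr01.
apply/near_pairP; exists e; first exact: e0.
move=> Y Y1 _ pY.
have Y2 : Y.2 = X.2 by rewrite [LHS]thinmx0 [RHS]thinmx0.
pose k := `|Y.1 - X.1|; pose th := k * q.
have k0 : 0 <= k by exact: normr_ge0.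
have th0 : 0 <= th by exact: mulr_ge0.
have the : th <= e * q by apply: ler_wpM2r => //; exact: ltW.
have th1 : th < 2^-1 by exact: le_lt_trans the eq_lt.
have /andP[lo hi] : (1 - th) * lambda X <= lambda Y <= (1 + th) * lambda X.
  apply: lambda_perturb => //; first by rewrite th0 (lt_trans th1) // invf_lt1 // ltr1n.
  move=> x; apply: le_trans (bform_le _ _ _) _.
  rewrite (_ : _ * _ = th * (c * `|x| ^+ 2)); last by rewrite /th /q /k; field;
    rewrite gt_eqF.
  exact: ler_wpM2l.
have lY : 0 < lambda Y by apply: lt_le_trans lo;
  rewrite mulr_gt0 // subr_gt0 (lt_trans th1) // invf_lt1 // ltr1n.
pose a := lambda X / lambda Y; have a0 : 0 < a by rewrite divr_gt0.
(* Uses [|lambda X - lambda Y| <= th lambda X] and [lambda X <= 2 lambda Y], the latter from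
   [th < 1 / 2]. *)
have a1 : `|a - 1| <= 2 * th.
  have -> : a - 1 = (lambda X - lambda Y) / lambda Y by rewrite mulrBl divff ?gt_eqF.
  rewrite normrM normfV (gtr0_norm lY) ler_pdivrMr // ler_norml.
  by move: lo hi th0 th1 lX lY; move: (lambda X) (lambda Y) (th) => x y h; nra.
have lZ : lambda (a *: Y.1, Y.2) = lambda X by rewrite lambda_scale // divfK ?gt_eqF.
rewrite -(delta_scale d0 a0 pY).
have [->//|/eqP ZX] := eqVneq (a *: Y.1, Y.2) X.
apply/ltW/hr => //=; last 2 first.
- by rewrite Y2 subrr normr0.
- exact: pos_defZ.
have -> : a *: Y.1 - A^T *m A = (a - 1) *: Y.1 + (Y.1 - X.1).
  by rewrite scalerBl scale1r addrA subrK.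
apply: le_lt_trans (ler_normD _ _) _; rewrite normrZ -/k.
have nY : `|Y.1| <= `|X.1| + 1.
  rewrite -[Y.1](subrK X.1) addrC; apply: le_trans (ler_normD _ _) _.
  by rewrite lerD2l ltW // (lt_trans Y1) //; lra.
have : `|a - 1| * `|Y.1| <= 2 * th * (`|X.1| + 1) by apply: ler_pM.
have : th * (`|X.1| + 1) <= e * q * (`|X.1| + 1) by rewrite ler_wpM2r.
have : 0 <= e * q * (`|X.1| + 1).
  by apply: mulr_ge0 => //; apply: mulr_ge0 => //; exact: ltW.
have : k < e by exact: Y1.
by move: eg; rewrite /g; lra.
Unshelve. all: by end_near. Qed.

(** A floating motion keeps the determinant and does not lower [lambda]. Shrinking the matrix by
    [c = lambda X / lambda Xe <= 1] restores [lambda X] without raising the determinant, so the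
    density is at least [delta X]; yet the form differs from [X] in its translations. *)
Lemma strict_nonfloating (R : realType) (d : nat) (L : set 'cV[R]_d) :
  (0 < d)%N -> is_lattice L -> strict_periodic_extreme L -> ~ floating L.
Proof.
move=> d0 latL spe [n [X [rX [tN [e0 [tN0 e00 he]]]]]].
have sL : subgroup L by case: latL.
have [A fA] := represents_frame sL rX.
have lX : 0 < lambda X.
  rewrite (frame_lambda sL fA); have [A0 uA0 LE] := lattice_basis latL.
  exact: min_norm_gt0 uA0 LE.
have pX := frame_pos_def fA.
have /near_pairP[r r0 hr] := spe _ _ rX.
(* Chosen so that [lambda Xe < lambda X + rho] forces [(1 - c) |X.1| < r], which keeps the rescaled
   form in the neighbourhood. *)
pose rho := r * lambda X / (`|X.1| + 1).
have n0 : 0 < `|X.1| + 1 by rewrite ltr_wpDl.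
have rho0 : 0 < rho by rewrite divr_gt0 // mulr_gt0.
(* A nearly minimal triple, followed along the motion, bounds [lambda Xe] from above: for [e <= 1]
   its value grows by at most [e b]. *)
have [i [j [v [adm hx]]]] : exists i j v, admissible i j v /\
    qform X.1 (diff_vec X.2 i j v) < lambda X + rho / 2.
  apply: contrapT => h; have : lambda X + rho / 2 <= lambda X.
    apply: lambda_ge => // i j v adm; rewrite leNgt; apply/negP => lt.
    by apply: h; exists i, j, v.
  lra.
set x := diff_vec X.2 i j v in hx; pose u := rel_shift tN i j.
pose b := 2 * `|bform X.1 x u| + qform X.1 u.
have b0 : 0 <= b by rewrite addr_ge0 ?mulr_ge0 // pos_def_ge0.
have [e [ep ee er eb e1]] : exists e : R, [/\ 0 < e, e <= e0, e * `|tN| < r,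
    e * b < rho / 2 & e * 1 < 1].
  apply: (@filter_ex _ (0^'+)); near=> e; split; near: e.
  - exact: nbhs_right_gt.
  - exact: nbhs_right_ltW.
  - exact: near0_mul_lt.
  - by apply: near0_mul_lt => //; rewrite divr_gt0.
  - exact: near0_mul_lt ler01 ltr01.
pose Xe := (X.1, X.2 + e *: tN).
have le1 : lambda X <= lambda Xe by apply: he; rewrite ee ltW.
have le2 : lambda Xe < lambda X + rho.
  apply: le_lt_trans (lambda_le (X := Xe) (fun y => pos_def_ge0 y pX) adm) _.
  rewrite /= diff_vecD rel_shiftZ -/x -/u qformD ?bformZr ?qformZ; last by case: pX.
  have h1 : e * bform X.1 x u <= e * `|bform X.1 x u|.
    by apply: ler_wpM2l; [exact: ltW | exact: ler_norm].
  have h2 : e ^+ 2 * qform X.1 u <= e * qform X.1 u.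
    apply: ler_wpM2r; first exact: pos_def_ge0.
    by rewrite expr2 ler_piMr ?ltW //; lra.
  by move: eb; rewrite /b mulrDr; lra.
have lXe : 0 < lambda Xe by apply: lt_le_trans le1.
pose c := lambda X / lambda Xe.
have c0 : 0 < c by rewrite divr_gt0.
have c1 : c <= 1 by rewrite ler_pdivrMr // mul1r.
pose Y := (c *: X.1, X.2 + e *: tN).
have lY : lambda Y = lambda X.
  by rewrite (_ : Y = (c *: Xe.1, Xe.2)) // lambda_scale // divfK // gt_eqF.
have pY : pos_def Y.1 by apply: pos_defZ.
have : delta Y < delta X.
  apply: hr => //=; last 1 first.
  - move=> /(congr1 snd) /= /eqP; rewrite -subr_eq0 addrC addKr scaler_eq0.
    by rewrite (negPf tN0) orbF gt_eqF.
  - have -> : c *: X.1 - X.1 = (c - 1) *: X.1 by rewrite scalerBl scale1r.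
    have h1 : (1 - c) * lambda Xe = lambda Xe - lambda X.
      by rewrite mulrBl mul1r divfK // gt_eqF.
    have h2 : (1 - c) * lambda X < rho.
      apply: le_lt_trans (_ : (1 - c) * lambda Xe < rho); last by rewrite h1; lra.
      by apply: ler_wpM2l; rewrite ?subr_ge0.
    rewrite normrZ distrC ger0_norm ?subr_ge0 //.
    apply: (@le_lt_trans _ _ ((1 - c) * (`|X.1| + 1))).
      by apply: ler_wpM2l; rewrite ?subr_ge0 // lerDl.
    move: h2; rewrite /rho ltr_pdivlMr // mulrAC ltr_pM2r //.
  - by rewrite addrC addKr normrZ gtr0_norm.
apply/negP; rewrite -leNgt; apply: delta_le; rewrite ?lY // ?(ltW lX) //.
  by have [] := pos_def_det pY.
rewrite /= detZ ler_piMl // ?exprn_ile1 // ?(ltW c0) //.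
by have [/ltW] := pos_def_det pX.
Unshelve. all: by end_near. Qed.

Theorem theorem3p4 (R : realType) (d : nat) (L : set 'cV[R]_d) :
  (0 < d)%N -> is_lattice L ->
  (strict_periodic_extreme L <-> extreme L /\ ~ floating L).
Proof.
move=> d0 latL; split=> [spe|[eL nfl] n X rX].
  by split; [exact: strict_extreme | exact: strict_nonfloating].
have sL : subgroup L by case: latL.
have [A fA] := represents_frame sL rX.
apply: (nonfloating_isolated d0 sL fA eL) => fX.
by apply: nfl; exists n, X.
Qed.
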